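(* In the setting described in the context, let $\mathfrak m$ denote the maximal ideal of $R/\pi$. Then the Hilbert–Samuel multiplicity of $R/\pi$ (with respect to $\mathfrak m$) is $$e(R/\pi)=\begin{cases}1,&\text{if }\bar\rho\text{ is ramified},\\2,&\text{if }\bar\rho\text{ is unramified and indecomposable},\\4,&\text{if }\bar\rho\text{ is split}.\end{cases}$$
   Context: Let $p>2$ be a prime, $k$ a finite field of characteristic $p$, $E$ a finite totally ramified extension of $W(k)[\frac1p]$ with ring of integers $\mathcal O$ and uniformizer $\pi$; $[\cdot]$ denotes Teichmüller lift $k\to\mathcal O$. Let $\epsilon$ be the $p$-adic cyclotomic character of $G_{\mathbb Q_p}$. Let $G$ be the maximal pro-$p$ quotient of $G_{\mathbb Q_p}$; its abelianization is identified with $(1+p\mathbb Z_p)\times\mathbb Z_p$, where the first coordinate is given by $\epsilon^{p-1}$ and the second by the projection to the maximal pro-$p$ quotient $\mathbb Z_p$ of $\mathrm{Gal}(\mathbb Q_p^{ur}/\mathbb Q_p)\cong\hat{\mathbb Z}$ (Frobenius $\mapsto 1$). Let $\gamma,\delta\in G$ be elements whose images in $G^{ab}$ are $(1+p,0)$ and $(1,1)$ respectively; then $G$ is a free pro-$p$ group on $\gamma,\delta$. Let $\bar\rho\colon G_{\mathbb Q_p}\to\mathrm{GL}_2(k)$, $g\mapsto\begin{pmatrix}1&\phi(g)\\0&1\end{pmatrix}$ be a continuous representation (it factors through $G$). Set $v:=\frac{1-\epsilon^{p-1}(\gamma)}{2}$. In $\mathcal O[[x_{11},\hat x_{12},x_{21},y_{11},\hat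 y_{12},y_{21}]]$ put $x_{12}:=\hat x_{12}+[\phi(\gamma)]$, $y_{12}:=\hat y_{12}+[\phi(\delta)]$ and $I_1=(v+x_{11})(v-x_{11})-x_{12}x_{21}$, $I_2=(v+x_{11})^2y_{12}-2(v+x_{11})x_{12}y_{11}-x_{12}^2y_{21}$, $I_3=x_{21}^2y_{12}-2x_{12}(v-x_{11})y_{11}-(v-x_{11})^2y_{21}$, $I_4=(v+x_{11})x_{21}y_{12}-2x_{12}x_{21}y_{11}-x_{12}(v-x_{11})y_{21}$. Define $R:=\mathcal O[[x_{11},\hat x_{12},x_{21},y_{11},\hat y_{12},y_{21}]]/(I_1,I_2,I_3,I_4)$. ''$\bar\rho$ ramified'' means $\bar\rho$ is nontrivial on inertia; ''split'' means $\bar\rho$ is trivial (i.e. $\phi=0$); ''unramified, indecomposable'' means $\phi\neq0$ but $\bar\rho$ is trivial on inertia.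
   Formalization: The middle term of I_3 is corrected to 2x_{21}(v-x_{11})y_{11} (printed: 2x_{12}(v-x_{11})y_{11}); with the printed I_3 the ramified case gives k[[x_{11},x̂_{12},y_{11},ŷ_{12}]]/(x_{11}y_{11}), of multiplicity 2 instead of 1. *)

(* Defs.v *)
From HB Require Import structures.
From mathcomp Require Import all_boot all_order all_algebra all_field.
From mathcomp Require Import boolp.
From mathcomp Require Import mpoly.

Set Implicit Arguments.
Unset Strict Implicit.
Unset Printing Implicit Defensive.

Import GRing.Theory.
Local Open Scope ring_scope.

Record mfps (n : nat) (R : Type) := MFps { fpscoef : 'X_{1..n} -> R }.

HB.instance Definition _ (n : nat) (R : Type) := gen_eqMixin (mfps n R).
HB.instance Definition _ (n : nat) (R : Type) := gen_choiceMixin (mfps n R).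

Section MfpsRing.
Variables (n : nat) (R : comNzRingType).
Implicit Types (f g h : mfps n R) (m : 'X_{1..n}).

Lemma mfpsP f g : (forall m, fpscoef f m = fpscoef g m) -> f = g.
Proof. by case: f g => [f] [g] /= /funext ->. Qed.

Definition mfps_zero : mfps n R := MFps (fun=> 0).
Definition mfps_opp f : mfps n R := MFps (fun m => - fpscoef f m).
Definition mfps_add f g : mfps n R := MFps (fun m => fpscoef f m + fpscoef g m).
Definition mfps_const (c : R) : mfps n R :=
  MFps (fun m => if m == 0%MM then c else 0).
Definition mfps_mul f g : mfps n R :=
  MFps (fun m => \sum_(d : 'X_{1..n < (mdeg m).+1} | (d <= m)%MM)
                    fpscoef f d * fpscoef g (m - d)%MM).
Definition mfps_var (i : 'I_n) : mfps n R :=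
  MFps (fun m => if m == U_(i)%MM then 1 else 0).

Fact mfps_addA : associative mfps_add.
Proof. by move=> f g h; apply: mfpsP => m /=; rewrite addrA. Qed.
Fact mfps_addC : commutative mfps_add.
Proof. by move=> f g; apply: mfpsP => m /=; rewrite addrC. Qed.
Fact mfps_add0 : left_id mfps_zero mfps_add.
Proof. by move=> f; apply: mfpsP => m /=; rewrite add0r. Qed.
Fact mfps_addN : left_inverse mfps_zero mfps_opp mfps_add.
Proof. by move=> f; apply: mfpsP => m /=; rewrite addNr. Qed.

HB.instance Definition _ := GRing.isZmodule.Build (mfps n R)
  mfps_addA mfps_addC mfps_add0 mfps_addN.

Definition mfps_trunc (N : nat) f : {mpoly R[n]} :=
  \sum_(m : 'X_{1..n < N}) (fpscoef f m *: 'X_[m]).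

Lemma mcoeff_trunc N f m : (mdeg m < N)%N -> (mfps_trunc N f)@_m = fpscoef f m.
Proof. exact: mcoeff_mpoly. Qed.

Lemma mcoeffM_trunc (P Q : {mpoly R[n]}) f g m :
  (forall d, (mdeg d <= mdeg m)%N -> P@_d = fpscoef f d) ->
  (forall d, (mdeg d <= mdeg m)%N -> Q@_d = fpscoef g d) ->
  (P * Q)@_m = fpscoef (mfps_mul f g) m.
Proof.
move=> HP HQ.
rewrite (@mcoeff_poly_mul_lin _ _ P Q m (mdeg m).+1) //=.
apply: eq_bigr => d _; rewrite HP ?HQ ?mdegB //.
by rewrite -ltnS bmdeg.
Qed.

Fact mfps_mulA : associative mfps_mul.
Proof.
move=> f g h; apply: mfpsP => m; pose N := (mdeg m).+1.
pose T := mfps_trunc N.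
have TE u d : (mdeg d <= mdeg m)%N -> (T u)@_d = fpscoef u d.
  by move=> le; apply: mcoeff_trunc; rewrite ltnS.
have TM u v d : (mdeg d <= mdeg m)%N -> (T u * T v)@_d = fpscoef (mfps_mul u v) d.
  move=> le; apply: mcoeffM_trunc => e le'.
  - by apply: TE; apply: leq_trans le' le.
  - by apply: TE; apply: leq_trans le' le.
rewrite -(@mcoeffM_trunc (T f) (T g * T h)) //; last by move=> d; apply: TM.
  rewrite mulrA; apply: mcoeffM_trunc => //.
    by move=> d; apply: TM.
  by move=> d; apply: TE.
by move=> d; apply: TE.
Qed.

Fact mfps_mulC : commutative mfps_mul.
Proof.
move=> f g; apply: mfpsP => m; pose N := (mdeg m).+1.
have TE u d : (mdeg d <= mdeg m)%N -> (mfps_trunc N u)@_d = fpscoef u d.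
  by move=> le; apply: mcoeff_trunc; rewrite ltnS.
rewrite -(@mcoeffM_trunc (mfps_trunc N f) (mfps_trunc N g)) //.
- by rewrite mulrC; apply: mcoeffM_trunc => // d; apply: TE.
- by move=> d; apply: TE.
- by move=> d; apply: TE.
Qed.

Fact mfps_mul1 : left_id (mfps_const 1) mfps_mul.
Proof.
move=> f; apply: mfpsP => m; pose N := (mdeg m).+1.
have TE u d : (mdeg d <= mdeg m)%N -> (mfps_trunc N u)@_d = fpscoef u d.
  by move=> le; apply: mcoeff_trunc; rewrite ltnS.
rewrite -(@mcoeffM_trunc 1 (mfps_trunc N f)) //.
- by rewrite mul1r TE.
- by move=> d _ /=; rewrite mcoeff1; case: eqP.
- by move=> d; apply: TE.
Qed.

Fact mfps_mulDl : left_distributive mfps_mul mfps_add.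
Proof.
move=> f g h; apply: mfpsP => m /=; rewrite -big_split /=.
by apply: eq_bigr => d _; rewrite mulrDl.
Qed.

Fact mfps_1neq0 : mfps_const 1 != 0 :> mfps n R.
Proof.
apply/eqP => /(congr1 (fun f => fpscoef f 0%MM)) /= /eqP.
by rewrite eqxx oner_eq0.
Qed.

HB.instance Definition _ := GRing.Zmodule_isComNzRing.Build (mfps n R)
  mfps_mulA mfps_mulC mfps_mul1 mfps_mulDl mfps_1neq0.

End MfpsRing.

Section IdealQuotient.
Variables (A : comPzRingType) (s : seq A).

Definition fg_ideal : {pred A} :=
  fun x => `[< exists c : 'I_(size s) -> A, x = \sum_i c i * s`_i >].

Fact fg_ideal_zmod : zmod_closed fg_ideal.
Proof.
split=> [|x y /asboolP[c ->] /asboolP[d ->]]; apply/asboolP.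
  by exists (fun=> 0); rewrite big1 // => i _; rewrite mul0r.
exists (fun i => c i - d i); rewrite -sumrB.
by apply: eq_bigr => i _; rewrite mulrBl.
Qed.

HB.instance Definition _ := GRing.isZmodClosed.Build A fg_ideal fg_ideal_zmod.

Lemma fg_idealMl a x : x \in fg_ideal -> a * x \in fg_ideal.
Proof.
move=> /asboolP[c ->]; apply/asboolP; exists (fun i => a * c i).
by rewrite mulr_sumr; apply: eq_bigr => i _; rewrite mulrA.
Qed.

(* [A / (s)]; mathcomp's {ideal_quot _} would require a proof that the ideal
   is proper, so the ring structure is put on the underlying quotient group. *)
Definition ring_quot : Type := Quotient.quot fg_ideal.

HB.instance Definition _ := GRing.Zmodule.on ring_quot.

Local Notation Q := (Quotient.quot fg_ideal).
Local Open Scope quotient_scope.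

Definition to_quot (x : A) : ring_quot := \pi_Q x.

Definition rq_mul (x y : ring_quot) : ring_quot :=
  to_quot (repr (x : Q) * repr (y : Q)).

Lemma to_quotK (x : ring_quot) : to_quot (repr (x : Q)) = x.
Proof. exact: reprK. Qed.

Lemma to_quot_eq x y : (to_quot x = to_quot y) <-> (x - y \in fg_ideal).
Proof.
rewrite (@Quotient.idealrBE _ fg_ideal); split=> [E|/eqP//].
by apply/eqP.
Qed.

Lemma to_quotD : {morph to_quot : x y / x + y}.
Proof. by move=> x y; rewrite /to_quot; exact: (raddfD \pi_Q). Qed.

Lemma to_quotM x y : to_quot (x * y) = rq_mul (to_quot x) (to_quot y).
Proof.
apply/to_quot_eq; set x' := repr _; set y' := repr _.
have -> : x * y - x' * y' = y * (x - x') + x' * (y - y').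
  by rewrite !mulrBr addrA (mulrC y x) (mulrC y x') subrK.
by apply: rpredD; apply/fg_idealMl/to_quot_eq; rewrite to_quotK.
Qed.

Fact rq_mulA : associative rq_mul.
Proof.
by move=> x y z; rewrite -[x]to_quotK -[y]to_quotK -[z]to_quotK -!to_quotM mulrA.
Qed.
Fact rq_mulC : commutative rq_mul.
Proof. by move=> x y; rewrite /rq_mul mulrC. Qed.
Fact rq_mul1 : left_id (to_quot 1) rq_mul.
Proof. by move=> x; rewrite -[x]to_quotK -to_quotM mul1r. Qed.
Fact rq_mulDl : left_distributive rq_mul +%R.
Proof.
move=> x y z; rewrite -[x]to_quotK -[y]to_quotK -[z]to_quotK.
by rewrite -to_quotD -!to_quotM mulrDl to_quotD.
Qed.

HB.instance Definition _ := GRing.Zmodule_isComPzRing.Build ring_quot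
  rq_mulA rq_mulC rq_mul1 rq_mulDl.

End IdealQuotient.

Section Multiplicity.
Variable A : comPzRingType.
Implicit Types (I J m : A -> Prop).

Definition is_ideal I :=
  [/\ I 0, forall x y, I x -> I y -> I (x + y) & forall a x, I x -> I (a * x)].

Definition is_maximal_ideal m :=
  [/\ is_ideal m, ~ m 1 &
      forall I, is_ideal I -> ~ I 1 -> (forall x, m x -> I x) ->
        forall x, I x -> m x].

Definition ideal_power m (n : nat) : A -> Prop := fun x =>
  exists r (a : 'I_r -> A) (g : 'I_r -> 'I_n -> A),
    (forall i j, m (g i j)) /\ x = \sum_i a i * \prod_j g i j.

(* The submodules of A/J are the I/J with I an ideal containing J. *)
Definition submodule_chain J (l : nat) :=
  exists c : nat -> A -> Prop,
    [/\ forall i, (i <= l)%N -> is_ideal (c i),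
        forall i, (i <= l)%N -> forall x, J x -> c i x,
        forall i, (i < l)%N -> forall x, c i x -> c i.+1 x &
        forall i, (i < l)%N -> exists2 x, c i.+1 x & ~ c i x].

Definition quotient_length J (l : nat) :=
  submodule_chain J l /\ ~ submodule_chain J l.+1.

(* P is the Hilbert-Samuel polynomial: P(n) is the length of A/m^(n+1) for all
   large n. With d the degree of P, the multiplicity is d! times its leading
   coefficient. *)
Definition hilbert_samuel_multiplicity m (e : nat) :=
  exists P : {poly rat},
    [/\ P != 0,
        exists N : nat, forall n : nat, (N <= n)%N ->
          exists2 l : nat, quotient_length (ideal_power m n.+1) l
                         & P.[n%:R] = l%:R
      & e%:R = ((size P).-1)`!%:R * lead_coef P].

End Multiplicity.

(* For k perfect of characteristic p, W(k) is up to unique isomorphism the only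
   p-torsion free, p-adically separated and complete ring with residue ring
   W(k)/p = k (the strict p-ring of k). In particular Z_p = W(F_p). *)
Definition is_witt_ring (p : nat) (k : fieldType) (W : idomainType)
    (res : {rmorphism W -> k}) :=
  [/\ p%:R != 0 :> W,
      forall a, exists w, res w = a,
      forall w, res w = 0 <-> (exists u, w = p%:R * u),
      forall w : W, (forall n, exists u, w = p%:R ^+ n * u) -> w = 0
    & forall s : nat -> W, (forall n, exists u : W, s n.+1 - s n = p%:R ^+ n * u) ->
        exists l, forall n, exists u : W, l - s n = p%:R ^+ n * u].

Definition is_ring_of_integers (W : idomainType)
    (E : fieldExtType {fraction W}) (O : idomainType) (j : {rmorphism O -> E}) :=
  injective j /\
  forall x : E,
    integralOver (fun w : W => (tofrac w)%:A : E) x <-> exists a, j a = x.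

(* The residue field k of W(k) is also the residue field of O, i.e. the
   extension has residue degree 1, and pi generates the maximal ideal. *)
Definition is_totally_ramified (k : fieldType) (W : idomainType)
    (resW : {rmorphism W -> k}) (E : fieldExtType {fraction W})
    (O : idomainType) (j : {rmorphism O -> E})
    (resO : {rmorphism O -> k}) (pi : O) :=
  (forall a w, j a = (tofrac w)%:A -> resO a = resW w) /\
  (forall a, resO a = 0 <-> exists b, a = pi * b).

Definition is_teichmuller (k : fieldType) (O : idomainType)
    (res : {rmorphism O -> k}) (T : k -> O) :=
  (forall a, res (T a) = a) /\ {morph T : a b / a * b}.

Section Galois.
Variables (K L : fieldType) (iota : {rmorphism K -> L}).

Definition is_aut_over (s : L -> L) :=
  [/\ bijective s, zmod_morphism s, monoid_morphism s
    & forall x, s (iota x) = iota x].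

Definition absgal : Type := {s : L -> L | `[< is_aut_over s >]}.
HB.instance Definition _ := Choice.on absgal.
Definition mk_gal (s : L -> L) (Hs : `[< is_aut_over s >]) : absgal :=
  exist (fun s => `[< is_aut_over s >]) s Hs.

Definition gal_fun (s : absgal) : L -> L := sval s.
Coercion gal_fun : absgal >-> Funclass.

Lemma galP (s t : absgal) : (forall x, s x = t x) -> s = t.
Proof. by move=> /funext E; apply: val_inj. Qed.

Lemma gal_autP (s : absgal) : is_aut_over s.
Proof. exact/asboolP/(valP s). Qed.

Fact gal_one_subproof : `[< is_aut_over id >].
Proof. by apply/asboolP; split=> //; exists id. Qed.
Definition gal_one : absgal := mk_gal gal_one_subproof.

Fact gal_mul_subproof (s t : absgal) : `[< is_aut_over (s \o t) >].
Proof.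
apply/asboolP; have [bs ds [ms1 ms] fs] := gal_autP s.
have [bt dt [mt1 mt] ft] := gal_autP t; split.
- exact: bij_comp.
- by move=> x y /=; rewrite dt ds.
- by split=> [|x y] /=; rewrite ?mt1 ?ms1 // mt ms.
- by move=> x /=; rewrite ft fs.
Qed.
Definition gal_mul (s t : absgal) : absgal := mk_gal (gal_mul_subproof s t).

Fact gal_inv_ex (s : absgal) :
  exists t : absgal, (forall x, t (s x) = x) /\ (forall x, s (t x) = x).
Proof.
have [[t st ts] ds [ms1 ms] fs] := gal_autP s.
have Pt : `[< is_aut_over t >].
  apply/asboolP; split.
  - by exists s.
  - by move=> x y; apply: (can_inj st); rewrite ds !ts.
  - by split=> [|x y]; apply: (can_inj st); rewrite ?ms !ts ?ms1.
  - by move=> x; rewrite -{1}fs st.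
by exists (mk_gal Pt).
Qed.
Definition gal_inv (s : absgal) : absgal := projT1 (cid (gal_inv_ex s)).

Fact gal_mulA : associative gal_mul.
Proof. by move=> s t u; apply: galP. Qed.
Fact gal_mul1 : left_id gal_one gal_mul.
Proof. by move=> s; apply: galP. Qed.
Fact gal_mulr1 : right_id gal_one gal_mul.
Proof. by move=> s; apply: galP. Qed.
Fact gal_mulV : left_inverse gal_one gal_inv gal_mul.
Proof. by move=> s; apply: galP => x; rewrite /gal_inv; case: cid => t /= []. Qed.
Fact gal_mulrV : right_inverse gal_one gal_inv gal_mul.
Proof. by move=> s; apply: galP => x; rewrite /gal_inv; case: cid => t /= []. Qed.

HB.instance Definition _ := isGroup.Build absgal
  gal_mulA gal_mul1 gal_mulr1 gal_mulV gal_mulrV.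

Definition krull_open (U : absgal -> Prop) :=
  forall s, U s -> exists r : seq L,
    forall t : absgal, {in r, forall x, t x = s x} -> U t.

End Galois.

Section Subgroups.
Variable G : groupType.
Local Open Scope group_scope.

Definition is_normal_subgroup (N : G -> Prop) :=
  [/\ N 1, forall x y, N x -> N y -> N (x * y), forall x, N x -> N x^-1
    & forall x y, N x -> N (x ^ y)].

Definition has_index (N : G -> Prop) (i : nat) :=
  exists c : G -> 'I_i, (forall j, exists x, c x = j) /\
    forall x y, c x = c y <-> N (x^-1 * y).

End Subgroups.

Section MaximalProPQuotient.
Variables (p : nat) (K L : fieldType) (iota : {rmorphism K -> L}).
Variables (G : groupType) (pr : absgal iota -> G).
Local Open Scope group_scope.

Definition is_maximal_pro_p_quotient :=
  [/\ {morph pr : s t / s * t}, forall g, exists s, pr s = g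
    & forall s, pr s = 1 <->
        forall N, is_normal_subgroup N -> krull_open N ->
          (exists n, has_index N (p ^ n)%N) -> N s].

(* [ab] identifies G/closure([G,G]) with (1 + p Z_p) x Z_p; G carries the
   quotient topology, and in the profinite group G the closure of the
   commutator subgroup is the intersection of the open normal subgroups
   containing all commutators. *)
Definition is_abelianization (Zp : comNzRingType) (ab : G -> Zp * Zp) :=
  [/\ forall g h, ab (g * h) = ((ab g).1 * (ab h).1, (ab g).2 + (ab h).2)%R,
      forall a b, (exists g, ab g = (a, b)) <->
                  exists u, a = (1 + p%:R * u)%R
    & forall g, ab g = (1%R, 0%R) <->
        forall N, is_normal_subgroup N -> krull_open (fun s => N (pr s)) ->
          (forall x y, N [~ x, y]) -> N g].

End MaximalProPQuotient.

Section LocalGalois.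
Variables (p : nat) (Zp : idomainType) (L : fieldType).
Variable iota : {rmorphism {fraction Zp} -> L}.
Local Notation GQp := (absgal iota).

Definition integral_elt (x : L) := integralOver (fun a : Zp => iota (tofrac a)) x.

(* The maximal ideal of the ring of integers of L: x has positive valuation
   iff p divides some power of x. *)
Definition in_max_ideal (x : L) :=
  exists n : nat, integral_elt (x ^+ n / p%:R).

Definition inertia (s : GQp) := forall x, integral_elt x -> in_max_ideal (s x - x).

Definition is_cyclotomic_character (eps : GQp -> Zp) :=
  forall s n z (j : nat), z ^+ (p ^ n) = 1 ->
    (exists u, eps s - j%:R = p%:R ^+ n * u) -> s z = z ^+ j.

(* s acts as the t-th power of the Frobenius x |-> x ^ p on the subfield with
   p ^ f elements of the residue field of L *)
Definition acts_as_frob_power (s : GQp) (f t : nat) :=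
  forall x, integral_elt x -> in_max_ideal (x ^+ (p ^ f) - x) ->
    in_max_ideal (s x - x ^+ (p ^ t)).

(* [unr] is G_Qp -> Gal(Qp^ur/Qp) = Zhat -> Z_p: the image of s in Z/f is the
   class of t, and [unr s] is the p-component of these classes. *)
Definition is_unramified_coordinate (unr : GQp -> Zp) :=
  forall s f, (0 < f)%N -> exists2 t : nat, acts_as_frob_power s f t &
    forall n, (p ^ n %| f)%N -> exists u, unr s - t%:R = p%:R ^+ n * u.

Variable k : fieldType.

Definition rhobar (phi : GQp -> k) (s : GQp) : 'M[k]_2 :=
  \matrix_(i, j) (if i == j then 1 else if (i < j)%N then phi s else 0).

Definition is_continuous_rep (rho : GQp -> 'M[k]_2) :=
  [/\ forall s, rho s \in unitmx,
      forall s t, rho (s * t)%g = rho s *m rho t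
    & forall M, krull_open (fun s => rho s = M)].

Definition ramified (rho : GQp -> 'M[k]_2) := exists2 s, inertia s & rho s <> 1%:M.
Definition split_rep (rho : GQp -> 'M[k]_2) := forall s, rho s = 1%:M.
Definition unramified_indecomposable (rho : GQp -> 'M[k]_2) :=
  ~ split_rep rho /\ ~ ramified rho.

End LocalGalois.

Section DeformationRing.
Variables (O : idomainType) (v phi_gamma phi_delta pi : O).

Local Notation S := (mfps 6 O).
Local Notation X i := (mfps_var O (inord i : 'I_6)).
Local Notation C c := (mfps_const 6 c).

Definition x11 : S := X 0.
Definition x12 : S := X 1 + C phi_gamma.
Definition x21 : S := X 2.
Definition y11 : S := X 3.
Definition y12 : S := X 4 + C phi_delta.
Definition y21 : S := X 5.

Definition I1 : S := (C v + x11) * (C v - x11) - x12 * x21.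
Definition I2 : S :=
  (C v + x11) ^+ 2 * y12 - 2%:R * (C v + x11) * x12 * y11 - x12 ^+ 2 * y21.
(* I2 and I3 are the values of the quadratic form
   y12 X^2 - 2 y11 X Y - y21 Y^2 at the rows (v + x11, x12) and
   (x21, v - x11) of one matrix; hence the factor x21 in the middle term. The
   printed formula has x12 there, a misprint: it would give multiplicity 2
   instead of 1 in the ramified case. *)
Definition I3 : S :=
  x21 ^+ 2 * y12 - 2%:R * x21 * (C v - x11) * y11 - (C v - x11) ^+ 2 * y21.
Definition I4 : S :=
  (C v + x11) * x21 * y12 - 2%:R * x12 * x21 * y11 - x12 * (C v - x11) * y21.

Definition def_ring : Type := ring_quot [:: I1; I2; I3; I4].
HB.instance Definition _ := GRing.ComPzRing.on def_ring.

Definition def_ring_const (c : O) : def_ring := to_quot [:: I1; I2; I3; I4] (C c).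

Definition def_ring_mod_pi : Type := ring_quot [:: def_ring_const pi].
HB.instance Definition _ := GRing.ComPzRing.on def_ring_mod_pi.

End DeformationRing.

(* Main.v *)
Require Import Defs.
From HB Require Import structures.
From mathcomp Require Import all_boot all_order all_algebra all_field.
From mathcomp Require cyclic.
From mathcomp Require Import boolp mpoly zify ring.
Import GRing.Theory.
Local Open Scope ring_scope.

(* Modulo pi the constant v vanishes and R/pi = k[[6 variables]]/(I1, ..., I4), so
   only a = phi(gamma) and b = phi(delta) matter. The character phi factors
   through the abelianization, in which every element is a product of powers of
   gamma and delta and of a p-th power. Inertia has trivial second coordinate
   and conversely the "p-part" of a lift of gamma lies in inertia; hence rho is
   ramified iff a != 0, and otherwise it is split iff b = 0.

   If a != 0 then x12 is a unit, the relations eliminate x21 and y21, and the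
   quotient is a power series ring in four variables. If a = 0, put
   q = x11^2 + x12 x21 and l = x21 y12 + 2 x11 y11 + x12 y21: the ideal is
   (q, x11 l, x12 l, x21 l). The cone q = 0 is parametrized by
   (s t, s^2, - t^2), so that the order function on k[x, y]/(q) is a valuation,
   and multiplication by l, of order e = 1 (b != 0) or e = 2 (b = 0), computes
     H(N) = Hq(N) - Hq(N - e) + 'C(N - e + 2, 3),
   where H(N), Hq(N) = 'C(N + 5, 6) - 'C(N + 3, 6) are the colengths of the
   N-th powers of the maximal ideals modulo the full ideal and modulo q. *)

Set Implicit Arguments.
Unset Strict Implicit.
Unset Printing Implicit Defensive.

(** * Codimension and length *)

(** The multiplicity can be read off the recursion: Hq(N) grows like 2 N^5 / 5!, so Hq(N) - Hq(N -
    e) grows like 2 e N^4 / 4!, while the binomial term has degree 3 only; hence 2 e. That term is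
    there because l is multiplied only by the ideal (x11, x12, x21), whose quotient ring still
    contains the three y variables. Length is defined by chains of ideals in a quotient of power
    series over O. A series may be cut at order N before membership in the N-th power of m is
    tested, so all counting is done with polynomials over k, and length is a k-dimension because the
    residue field is k. On the Galois side, a lift of gamma has trivial image in Z_p but perhaps not
    in Zhat, so it need not lie in inertia; its prime-to-p part has to be removed without changing
    phi. The p-th powers arise because, for p odd, those of 1 + p Z_p fill 1 + p^2 Z_p. *)

Section Codim.
Variable k : fieldType.

(** The quotient is given by a linear surjection onto a row space, so [J] may stay a bare predicate
    and no quotient of a possibly infinite-dimensional [V] has to be formed. *)
Definition codim (V : lmodType k) (J : V -> Prop) (d : nat) :=
  exists D : {linear V -> 'rV[k]_d},
    (forall y, exists x, D x = y) /\ (forall x, D x = 0 <-> J x).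

Lemma eq_codim (V : lmodType k) (J J' : V -> Prop) d :
  (forall x, J x <-> J' x) -> codim J d -> codim J' d.
Proof. by move=> E [D [Ds Dk]]; exists D; split=> // x; rewrite Dk. Qed.

Lemma codim_preim (V V' : lmodType k) (f : {linear V -> V'}) (J : V' -> Prop) d :
  (forall y, exists x, f x = y) -> codim J d -> codim (fun x => J (f x)) d.
Proof.
move=> fs [D [Ds Dk]]; exists (D \o f); split=> [y|x]; last by rewrite -Dk.
by have [x <-] := Ds y; have [z <-] := fs x; exists z.
Qed.

Lemma codimT (V : lmodType k) : codim (fun _ : V => True) 0.
Proof.
exists (\0%R : {linear V -> 'rV[k]_0}); split=> [y|//].
by exists 0; apply/rowP => -[].
Qed.

Lemma linear_row_decomp (V : lmodType k) r (u : 'I_r -> V) d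
  (D : {linear V -> 'rV[k]_d}) (z : 'rV[k]_r) :
  D (\sum_i z 0 i *: u i) = z *m (\matrix_i D (u i)).
Proof.
rewrite linear_sum mulmx_sum_row; apply: eq_bigr => i _.
by rewrite linearZ rowK.
Qed.

Lemma codim_add_image (V : lmodType k) (J J' U : V -> Prop) (mu : {linear V -> V})
    a b c :
  U 0 -> (forall t u u', U u -> U u' -> U (t *: u + u')) ->
  (forall u, U u -> J (mu u) <-> J' u) ->
  codim J a -> codim J' b ->
  codim (fun x => exists u y, [/\ U u, J' y & x = u + y]) c ->
  codim (fun x => exists u y, [/\ U u, J y & x = mu u + y]) (a - (b - c)).
Proof.
move=> U0 UD muJ [D1 [D1s D1k]] [D2 [D2s D2k]] [D3 [D3s D3k]].
have Usum r (u : 'I_r -> V) (z : 'rV[k]_r) : (forall i, U (u i)) ->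
    U (\sum_i z 0 i *: u i).
  move=> Uu; elim/big_ind: _ => [//|x y Ux Uy|i _].
    by rewrite -[x]scale1r; apply: UD.
  by rewrite -[_ *: _]addr0; apply: UD.
have [sec secK] := choice D2s.
(* The matrix of the projection V / J' -> V / (U + J'). *)
pose F : 'M[k]_(b, c) := \matrix_i D3 (sec (delta_mx 0 i)).
have FE x : D3 x = D2 x *m F.
  rewrite -linear_row_decomp; apply/eqP; rewrite -subr_eq0 -linearB; apply/eqP/D3k.
  exists 0; exists (x - \sum_i D2 x 0 i *: sec (delta_mx 0 i)).
  split; rewrite ?add0r //; apply/D2k; rewrite linearB linear_sum.
  under eq_bigr do rewrite linearZ secK.
  by rewrite -row_sum_delta subrr.
have rF : \rank F = c.
  apply/eqP; rewrite -[_ == c]/(row_full F) -sub1mx; apply/row_subP => i.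
  by have [x Dx] := D3s (row i 1%:M); rewrite -Dx FE submxMl.
(* The rows of [K] form a basis of (U + J') / J'; below, [u] lifts them to U and [W] is the matrix
   of the induced map into V / J. *)
pose K := row_base (kermx F).
have rK : \rank (kermx F) = (b - c)%N by rewrite mxrank_ker rF.
have exu i : exists u, U u /\ D2 u = row i K.
  have: row i K *m F = 0.
    by apply/sub_kermxP; rewrite (submx_trans (row_sub _ _)) // eq_row_base.
  rewrite -{1}[row i K]secK -FE => /D3k[u [y [Uu /D2k y0 E]]].
  by exists u; split=> //; rewrite -[row i K]secK E linearD y0 addr0.
have [u uP] := choice exu.
pose W : 'M[k]_(_, a) := \matrix_i D1 (mu (u i)).
have D2u (z : 'rV[k]_(\rank (kermx F))) : D2 (\sum_i z 0 i *: u i) = z *m K.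
  rewrite linear_row_decomp; congr (_ *m _); apply/row_matrixP => i.
  by rewrite rowK; case: (uP i).
have Uu (z : 'rV[k]_(\rank (kermx F))) : U (\sum_i z 0 i *: u i) by apply: Usum => i; case: (uP i).
have D1u (z : 'rV[k]_(\rank (kermx F))) : D1 (mu (\sum_i z 0 i *: u i)) = z *m W.
  rewrite linear_sum /=; under eq_bigr do rewrite linearZ.
  exact: linear_row_decomp.
have fW : row_free W.
  rewrite -kermx_eq0 -submx0; apply/rV_subP => z /sub_kermxP.
  rewrite -D1u => /D1k /(muJ _ (Uu z)) /D2k; rewrite D2u => zK.
  rewrite -[z](mulmxKp (row_base_free (kermx F))) /= -/K zK mul0mx; exact: sub0mx.
have rW : \rank W = (b - c)%N by rewrite -rK; apply/eqP.
(* Right multiplication by [C] is a surjection with kernel the row space of [W]. *)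
pose C := col_base (cokermx W).
have CE (x : 'rV_a) : x *m C = 0 <-> (x <= W)%MS.
  have -> : (x <= W)%MS = (x *m C *m row_base (cokermx W) == 0).
    by rewrite submxE -mulmxA mulmx_base.
  split=> [->|/eqP E].
    by rewrite mul0mx eqxx.
  by rewrite -[x *m C](mulmxKp (row_base_free (cokermx W))) E mul0mx.
have rC : \rank (cokermx W) = (a - (b - c))%N by rewrite mxrank_coker rW.
rewrite -rC; exists (mulmxr C \o D1); split=> [y|x] /=.
  have /row_fullP[C' CC] := col_base_full (cokermx W).
  by have [x Dx] := D1s (y *m C'); exists x; rewrite Dx -mulmxA CC mulmx1.
split.
  move/CE => /submxP[z Ez]; exists (\sum_i z 0 i *: u i).
  exists (x - mu (\sum_i z 0 i *: u i)); split=> //; last by rewrite addrC subrK.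
  by apply/D1k; rewrite linearB D1u Ez subrr.
case=> w [y [Uw /D1k y0 ->]]; apply/CE; rewrite linearD y0 addr0.
have: (D2 w <= K)%MS.
  rewrite eq_row_base; apply/sub_kermxP; rewrite -FE; apply/D3k.
  by exists w, 0; split=> //; [apply/D2k; rewrite linear0|rewrite addr0].
case/submxP=> z Ez; have: J' (w - \sum_i z 0 i *: u i).
  by apply/D2k; rewrite linearB D2u Ez subrr.
have Uz : U (w - \sum_i z 0 i *: u i).
  by rewrite addrC -scaleN1r; apply: UD.
move/(muJ _ Uz)/D1k; rewrite !linearB D1u => /eqP; rewrite subr_eq0 => /eqP ->.
exact: submxMl.
Qed.

(** Upper bound: the increments of a chain of length l + 1 would be linearly independent vectors of
    k^l. Lower bound: since J contains the products of N elements of M and every element is a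
    constant modulo M, a proper ideal above J can always be enlarged by exactly one dimension. *)
Lemma quotient_length_codim (A : comPzRingType) (J M : A -> Prop) l N
    (del : A -> 'rV[k]_l) (cst : k -> A) :
  is_ideal J -> {morph del : x y / x + y} ->
  (forall y, exists x, del x = y) -> (forall x, del x = 0 <-> J x) ->
  (forall t x, del (cst t * x) = t *: del x) ->
  (forall x, exists t, M (x - cst t)) ->
  (forall g : 'I_N -> A, (forall i, M (g i)) -> J (\prod_i g i)) ->
  quotient_length J l.
Proof.
move=> [J0 JD JM] delD dels delk delZ Mres nilM.
have del0 : del 0 = 0 by apply/delk.
have delN x : del (- x) = - del x.
  by apply/eqP; rewrite -addr_eq0 -delD addNr del0.
have delB x y : del (x - y) = del x - del y by rewrite delD delN.
split; last first.
  case=> c [cI cJ cS cX].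
  have /choice[x xP] (i : 'I_l.+1) : exists x, c i.+1 x /\ ~ c i x.
    by have [x] := cX i (ltn_ord i); exists x.
  pose X := \matrix_(i < l.+1) del (x i).
  have /rowV0Pn[u /sub_kermxP uX nu] : kermx X != 0.
    by rewrite -mxrank_eq0 mxrank_ker -lt0n subn_gt0 ltnS rank_leq_col.
  have [i0 ni0] : exists i, u 0 i != 0.
    by apply/existsP; apply: contraNT nu; rewrite negb_exists => /forallP h;
      apply/eqP/rowP => i; rewrite mxE; apply/eqP; have := h i; rewrite negbK.
  (* For the largest index [i] in the relation, [x i] is modulo J a combination of earlier
     increments, which all lie in [c i]. *)
  case: (@arg_maxnP _ i0 (fun i => u 0 i != 0) (fun i => val i) ni0) => i ni imax.
  have cle m n y : (m <= n)%N -> (n <= l.+1)%N -> c m y -> c n y.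
    move=> mn nl cm; elim: n mn nl => [|n IH]; first by rewrite leqn0 => /eqP<-.
    rewrite leq_eqVlt => /orP[/eqP<-//|mn nl].
    by apply: cS => //; apply: IH => //; apply: ltnW.
  have il := ltnW (ltn_ord i).
  have [ci0 ciD ciM] := cI i il.
  have ciN y : c i y -> c i (- y) by rewrite -mulN1r; apply: ciM.
  pose y := \sum_(j < l.+1 | j != i) cst (- (u 0 i)^-1 * u 0 j) * x j.
  have cy : c i y.
    apply: (big_ind (c i)) => // j ji.
    have [->|uj] := eqVneq (u 0 j) 0.
      by rewrite mulr0; apply: cJ => //; apply/delk; rewrite delZ scale0r.
    apply: ciM; apply: (cle j.+1) => //; last by case: (xP j).
    by rewrite ltn_neqAle ji; apply: imax.
  case: (xP i) => _; apply.
  have -> : x i = (x i - y) + y by rewrite subrK.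
  apply: ciD => //; apply: cJ => //; apply/delk; rewrite delB.
  have -> : del y = \sum_(j < l.+1 | j != i) (- (u 0 i)^-1 * u 0 j) *: del (x j).
    by rewrite /y (big_morph del delD del0); apply: eq_bigr => j _; rewrite delZ.
  move: uX; rewrite mulmx_sum_row (bigD1 i) //= => /(congr1 (fun z => (u 0 i)^-1 *: z)).
  rewrite scaler0 scalerDr scalerA mulVf // scale1r rowK => E.
  rewrite -[RHS]E; congr (_ + _); rewrite -sumrN scaler_sumr.
  by apply: eq_bigr => j _; rewrite rowK scalerA mulNr scaleNr opprK.
(* The chain is built together with a matrix [B] of i rows spanning the image of its top member,
   which records the dimension. *)
suff H i : (i <= l)%N -> exists (c : nat -> A -> Prop) (B : 'M[k]_(i, l)),
    [/\ forall y, c i y <-> (del y <= B)%MS,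
        forall j, (j <= i)%N -> is_ideal (c j),
        forall j, (j <= i)%N -> forall x, J x -> c j x,
        forall j, (j < i)%N -> forall x, c j x -> c j.+1 x &
        forall j, (j < i)%N -> exists2 x, c j.+1 x & ~ c j x].
  by have [c [B [_ h1 h2 h3 h4]]] := H l (leqnn l); exists c; split.
elim: i => [_|i IH il].
  exists (fun=> J), 0; split=> // y.
  split=> [/delk->|/submxP[w]]; first exact: sub0mx.
  by rewrite mulmx0 => /delk.
have [c [B [cB cI cJ cS cX]]] := IH (ltnW il).
have [C0 CD CM] := cI i (leqnn i).
have [x0 x0P] : exists x, ~ c i x.
  apply: contrapT => nex.
  have fB : row_full B.
    rewrite -sub1mx; apply/row_subP => j; have [x Ex] := dels (row j 1%:M).
    by rewrite -Ex; apply/cB; apply: contrapT => h; apply: nex; exists x.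
  have := rank_leq_row B; rewrite (eqP fB) leqNgt; apply/negP; rewrite negbK.
  exact: il.
(* A socle element modulo [c i]: multiply [x0] by elements of M as long as the product stays outside
   [c i], which happens fewer than N times. *)
have [x [xC xM]] : exists x, ~ c i x /\ forall g, M g -> c i (g * x).
  have: forall g : 'I_N -> A, (forall j, M (g j)) -> c i ((\prod_j g j) * x0).
    by move=> g Mg; rewrite mulrC; apply: CM; apply: cJ => //; apply: nilM.
  elim: (N) (x0) x0P => [|n IHn] x nx nil.
    case: nx; have: c i ((\prod_(j < 0) 1) * x) by apply: nil => -[].
    by rewrite big_ord0 mul1r.
  have [h|/existsNP[g /not_implyP[Mg ng]]] := pselect (forall g, M g -> c i (g * x)).
    by exists x.
  apply: (IHn (g * x)) => // h Mh.
  have := nil (fun j : 'I_n.+1 => if unlift ord_max j is Some j' then h j' else g).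
  rewrite big_ord_recr /= unlift_none -mulrA.
  have -> : \prod_(j < n) (if unlift ord_max (widen_ord (leqnSn n) j) is Some j'
      then h j' else g) = \prod_j h j.
    apply: eq_bigr => j _; have -> : widen_ord (leqnSn n) j = lift ord_max j.
      by apply: val_inj; rewrite /= /bump leqNgt ltn_ord.
    by rewrite liftK.
  by apply => j; case: unliftP.
pose B' : 'M[k]_(i.+1, l) := \matrix_j (if unlift ord_max j is Some j' then row j' B else del x).
have B'E (z : 'rV[k]_l) : (z <= B')%MS <-> exists t, (z - t *: del x <= B)%MS.
  split=> [/submxP[w Ew]|[t]].
    exists (w 0 ord_max); rewrite Ew mulmx_sum_row big_ord_recr /= rowK unlift_none addrK.
    apply: summx_sub => j _; rewrite scalemx_sub // rowK.
    case: unliftP => [j' _|/(congr1 val) /= E]; first exact: row_sub.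
    by have := ltn_ord j; rewrite {1}E ltnn.
  move=> h; rewrite -[z](subrK (t *: del x)); apply: addmx_sub.
    apply: submx_trans h _; apply/row_subP => j.
    have -> : row j B = row (lift ord_max j) B' by rewrite rowK liftK.
    exact: row_sub.
  have -> : del x = row ord_max B' by rewrite rowK unlift_none.
  by rewrite scalemx_sub // row_sub.
pose C' y := (del y <= B')%MS : Prop.
have C'E y : C' y <-> exists t, c i (y - cst t * x).
  rewrite /C' B'E; split=> -[t h]; exists t.
    by apply/cB; rewrite delB delZ.
  by move/cB: h; rewrite delB delZ.
have CC' y : c i y -> C' y.
  move=> cy; apply/C'E; exists 0; apply: (CD _ _ cy); rewrite -mulN1r.
  by apply: CM; apply: cJ => //; apply/delk; rewrite delZ scale0r.
have idC' : is_ideal C'.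
  split; first by apply: CC'.
    by move=> y z; rewrite /C' delD; apply: addmx_sub.
  move=> g y /C'E[t h]; have [s Ms] := Mres g.
  apply/C'E; exists (t * s).
  have -> : g * y - cst (t * s) * x =
    g * (y - cst t * x) + (cst t * ((g - cst s) * x) + (cst t * (cst s * x) - cst (t * s) * x)).
    by ring.
  apply: (CD _ _ (CM _ _ h)); apply: (CD _ _ (CM _ _ (xM _ Ms))).
  by apply: cJ => //; apply/delk; rewrite delB !delZ scalerA subrr.
exists (fun j => if (j <= i)%N then c j else C'), B'; split.
- by move=> y; rewrite ltnn.
- by move=> j _; case: leqP => // ji; apply: cI.
- by move=> j _; case: leqP => [ji|_] y Jy; [apply: cJ|apply: CC'; apply: cJ].
- move=> j; rewrite ltnS => ji y; rewrite ji /=; case: (ltnP j i) => [ji'|ij]; first exact: cS.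
  have -> : j = i by apply/eqP; rewrite eqn_leq ji.
  exact: CC'.
move=> j; rewrite ltnS => ji; rewrite ji; case: (ltnP j i) => [ji'|ij]; first exact: cX.
have -> : j = i by apply/eqP; rewrite eqn_leq ji.
exists x => //; apply/C'E; exists 1.
by apply: cJ => //; apply/delk; rewrite delB delZ scale1r subrr.
Qed.

End Codim.

(** * Order of polynomials *)

Section Order.
Variables (k : fieldType) (n : nat).
Local Notation P := {mpoly k[n]}.

Definition ordge (N : nat) (f : P) := forall m, (mdeg m < N)%N -> f@_m = 0.

Lemma ordge0 N : ordge N 0.
Proof. by move=> m _; rewrite mcoeff0. Qed.

Lemma ordgeD N f g : ordge N f -> ordge N g -> ordge N (f + g).
Proof. by move=> hf hg m hm; rewrite mcoeffD hf ?hg ?addr0. Qed.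

Lemma ordgeN N f : ordge N f -> ordge N (- f).
Proof. by move=> hf m hm; rewrite mcoeffN hf ?oppr0. Qed.

Lemma ordgeM a b f g : ordge a f -> ordge b g -> ordge (a + b) (f * g).
Proof.
move=> hf hg m hm; rewrite mcoeffM big1 // => d /eqP E.
have [ha|ha] := ltnP (mdeg d.1) a; first by rewrite hf // mul0r.
rewrite hg ?mulr0 // -(ltn_add2l (mdeg d.1)) -mdegD -E.
by apply: leq_trans hm _; rewrite leq_add2r.
Qed.

Lemma ordge_ge0 f : ordge 0 f.
Proof. by move=> m. Qed.

Lemma ordgeMl N f g : ordge N g -> ordge N (f * g).
Proof. by move=> hg; rewrite -[N]add0n; apply: ordgeM. Qed.

Lemma ordgeXn N f a : ordge 1 f -> (N <= a)%N -> ordge N (f ^+ a).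
Proof.
move=> hf; elim: N a => [//|N IH] [//|a] Na.
by rewrite exprS -add1n; apply: ordgeM => //; apply: IH.
Qed.

Lemma ordge_X N (m : 'X_{1..n}) : (N <= mdeg m)%N -> ordge N 'X_[m].
Proof.
by move=> Nm m' hm'; rewrite mcoeffX; case: eqP => // E; move: hm'; rewrite -E ltnNge Nm.
Qed.

Lemma ordge_var i : ordge 1 ('X_i : P).
Proof. by apply: ordge_X; rewrite mdeg1. Qed.

(** A multinomial of degree at most N has entries at most N, so it is a tuple over ['I_N.+1] with
    bounded sum. *)
Lemma card_bounded_multinom N : #|{: 'X_{1..n < N.+1}}| = 'C(n + N, n).
Proof.
rewrite -card_partial_ord_partitions.
pose F (t : n.-tuple 'I_N.+1) : 'X_{1..n} := [multinom of map val t].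
have FE t i : F t i = tnth t i :> nat by rewrite multinomE tnth_map.
have degF t : mdeg (F t) = (\sum_(i <- t) i)%N.
  by rewrite mdegE big_tuple; apply: eq_bigr => i _; rewrite FE.
pose G (t : n.-tuple 'I_N.+1) : 'X_{1..n < N.+1} := insubd bm0 (F t).
rewrite -(card_in_imset (f := G)); last first.
  move=> t u; rewrite !inE => ht hu /(congr1 val).
  rewrite !val_insubd !degF !ltnS ht hu => /mnmP E.
  by apply: eq_from_tnth => i; apply: val_inj; have := E i; rewrite !FE.
apply/esym/eq_card => m; apply/imsetP.
have le i : (m i < N.+1)%N.
  have := bmdeg m; rewrite !ltnS => /(leq_trans _); apply.
  by rewrite mdegE (bigD1 i) //= leq_addr.
have E : F [tuple Ordinal (le i) | i < n] = m.
  by apply/mnmP => i; rewrite FE tnth_mktuple.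
exists [tuple Ordinal (le i) | i < n].
  by rewrite inE -degF E -ltnS bmdeg.
by apply: val_inj; rewrite val_insubd E bmdeg.
Qed.

Definition low_coefs N (f : P) : 'rV[k]_#|{: 'X_{1..n < N}}| :=
  \row_i f@_(bmnm (enum_val i)).

Fact low_coefs_is_linear N : linear (low_coefs N).
Proof. by move=> c f g; apply/rowP => i; rewrite !mxE mcoeffD mcoeffZ. Qed.

HB.instance Definition _ N := GRing.isLinear.Build k P _ _ (low_coefs N)
  (@low_coefs_is_linear N).

Lemma codim_ordge N : codim (ordge N.+1) 'C(n + N, n).
Proof.
rewrite -card_bounded_multinom; exists (low_coefs N.+1); split=> [y|f].
  pose E (m : 'X_{1..n}) := y 0 (enum_rank (insubd bm0 m : 'X_{1..n < N.+1})).
  exists (\sum_(m : 'X_{1..n < N.+1}) E m *: 'X_[m]); apply/rowP => i.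
  by rewrite mxE mcoeff_mpoly ?bmdeg // /E valKd enum_valK.
split=> [/rowP h m hm|h]; last first.
  by apply/rowP => i; rewrite !mxE h ?bmdeg.
by have := h (enum_rank (BMultinom hm)); rewrite !mxE enum_rankK.
Qed.

End Order.

Section PolyOrder.
Variable T : idomainType.

Definition pord N (A : {poly T}) := forall d, (d < N)%N -> A`_d = 0.

(** Over a domain the lowest coefficients do not cancel, so orders add: multiplication by [B] is an
    exact shift of the order filtration. *)
Lemma pordM N e (A B : {poly T}) : pord e B -> B`_e != 0 ->
  pord (N + e) (B * A) <-> pord N A.
Proof.
move=> Be nB; split=> h d.
  elim/ltn_ind: d => d IH dN.
  have := h (d + e)%N; rewrite ltn_add2r => /(_ dN).
  have lt : (e < (d + e).+1)%N by rewrite ltnS leq_addl.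
  rewrite coefM (bigD1 (Ordinal lt)) //= big1 => [|i ni].
    by rewrite addr0 addnK => /eqP; rewrite mulf_eq0 (negPf nB) => /eqP.
  have [ie|ie] := ltnP i e; first by rewrite Be ?mul0r.
  have {ni}ie : (e < i)%N by rewrite ltn_neqAle ie eq_sym andbT.
  have := ltn_ord i; rewrite ltnS => il.
  by rewrite IH ?mulr0 //; lia.
move=> dN; rewrite coefM big1 // => i _; have := ltn_ord i; rewrite ltnS => il.
have [ie|ie] := ltnP i e; first by rewrite Be ?mul0r.
by rewrite h ?mulr0 //; lia.
Qed.

End PolyOrder.

Section Grading.
Variables (k : fieldType) (n : nat) (T : comNzRingType) (h : {rmorphism k -> T}).
Variable psi : 'I_n -> T.

(* The variable ['X] of {poly T} records the degree. *)
Definition graded_map : {mpoly k[n]} -> {poly T} :=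
  mmap (polyC \o h) (fun i => (psi i)%:P * 'X).

HB.instance Definition _ := GRing.RMorphism.on graded_map.

Lemma graded_mapC c : graded_map c%:MP = (h c)%:P.
Proof. by rewrite /graded_map mmapC. Qed.

Lemma graded_map_var i : graded_map 'X_i = (psi i)%:P * 'X.
Proof. by rewrite /graded_map mmapX mmap1U. Qed.

Lemma coef_graded_map f d : (graded_map f)`_d =
  \sum_(m <- msupp f | mdeg m == d) h f@_m * mmap1 psi m.
Proof.
rewrite /graded_map /mmap coef_sum [RHS]big_mkcond /=; apply: eq_bigr => m _.
have -> : mmap1 (fun i => (psi i)%:P * 'X) m = (mmap1 psi m)%:P * 'X^(mdeg m).
  rewrite /mmap1 rmorph_prod mdegE -prodrXr -big_split /=.
  by apply: eq_bigr => i _; rewrite exprMn rmorphXn.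
rewrite mulrA -polyCM coefCM coefXn eq_sym.
by case: eqP; rewrite ?mulr1 ?mulr0.
Qed.

End Grading.

Lemma pord_graded_map (k : fieldType) n (T : idomainType) (h : {rmorphism k -> T})
  (psi : 'I_n -> T) N f : ordge N f -> pord N (graded_map h psi f).
Proof.
move=> hf d dN; rewrite coef_graded_map big1 // => m /eqP E.
by rewrite hf ?E // rmorph0 mul0r.
Qed.

(** Substituting t X_i for X_i separates the homogeneous components; the order of a polynomial
    becomes an order in t, to which [pordM] applies. *)
Lemma pord_id_graded_map (k : fieldType) n N (f : {mpoly k[n]}) :
  pord N (graded_map (@mpolyC n k) (fun i => 'X_i) f) <-> ordge N f.
Proof.
split=> [hf m hm|]; last exact: pord_graded_map.
have := hf _ hm; rewrite coef_graded_map => /(congr1 (mcoeff m)).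
rewrite mcoeff0 raddf_sum /=.
have [ms|/memN_msupp_eq0//] := boolP (m \in msupp f).
rewrite -big_filter (bigD1_seq m) ?filter_uniq ?msupp_uniq //=; last first.
  by rewrite mem_filter eqxx.
rewrite mmap1_id mcoeffCM mcoeffX eqxx mulr1 big1 ?addr0 // => m' nm.
by rewrite mmap1_id mcoeffCM mcoeffX (negPf nm) mulr0.
Qed.

Section MulBy.
Variables (k : fieldType) (n : nat) (g : {mpoly k[n]}).
Definition mulby (f : {mpoly k[n]}) := g * f.
Fact mulby_is_linear : linear mulby.
Proof. by move=> c x y; rewrite /mulby mulrDr scalerAr. Qed.
HB.instance Definition _ := GRing.isLinear.Build k _ _ _ mulby mulby_is_linear.
End MulBy.

(** * The cone *)

Section ResidualIdeal.
Variables (k : fieldType) (a b : k).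
Local Notation P := {mpoly k[6]}.
Local Notation X i := ('X_(inord i : 'I_6) : P).

(** Variables 0 to 5 are x11, hat x12, x21, y11, hat y12, y21, and a, b stand for phi(gamma),
    phi(delta); the relations below are the original ones with v = 0. *)
Definition rx12 : P := X 1 + a%:MP.
Definition ry12 : P := X 4 + b%:MP.
Definition rI1 : P := - X 0 ^+ 2 - rx12 * X 2.
Definition rI2 : P := X 0 ^+ 2 * ry12 - 2%:R * X 0 * rx12 * X 3 - rx12 ^+ 2 * X 5.
Definition rI3 : P := X 2 ^+ 2 * ry12 + 2%:R * X 2 * X 0 * X 3 - X 0 ^+ 2 * X 5.
Definition rI4 : P := X 0 * X 2 * ry12 - 2%:R * rx12 * X 2 * X 3 + rx12 * X 0 * X 5.

(** The polynomial counterpart of the N-th power of the maximal ideal of R / pi; [ideal_powerP]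
    makes this precise. *)
Definition res_ideal (N : nat) (f : P) := exists h1 h2 h3 h4 r,
  ordge N r /\ f = h1 * rI1 + h2 * rI2 + h3 * rI3 + h4 * rI4 + r.

Lemma res_ideal_is_ideal N : is_ideal (res_ideal N).
Proof.
split.
- by exists 0, 0, 0, 0, 0; split; [apply: ordge0|rewrite !mul0r !addr0].
- move=> f g [h1 [h2 [h3 [h4 [r [hr ->]]]]]] [h1' [h2' [h3' [h4' [r' [hr' ->]]]]]].
  exists (h1 + h1'), (h2 + h2'), (h3 + h3'), (h4 + h4'), (r + r').
  by split; [apply: ordgeD|ring].
move=> c f [h1 [h2 [h3 [h4 [r [hr ->]]]]]].
by exists (c * h1), (c * h2), (c * h3), (c * h4), (c * r); split; [apply: ordgeMl|ring].
Qed.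

Lemma res_ideal_ordge N f : ordge N f -> res_ideal N f.
Proof. by move=> hf; exists 0, 0, 0, 0, f; split=> //; ring. Qed.

End ResidualIdeal.

Lemma forall_ord6 (Q : 'I_6 -> Prop) :
  Q (inord 0) -> Q (inord 1) -> Q (inord 2) -> Q (inord 3) -> Q (inord 4) -> Q (inord 5) ->
  forall i, Q i.
Proof.
move=> q0 q1 q2 q3 q4 q5 -[[|[|[|[|[|[|//]]]]]] lt];
  by have /= <- := inord_val (Ordinal lt).
Qed.

Section Cone.
Variable k : fieldType.
Local Notation P := {mpoly k[6]}.
Local Notation T := {mpoly k[5]}.
Local Notation X i := ('X_(inord i : 'I_6) : P).
Local Notation Y i := ('X_(inord i : 'I_5) : T).

Definition quad : P := X 0 ^+ 2 + X 1 * X 2.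
Definition quad_ideal N (f : P) := exists h r, ordge N r /\ f = quad * h + r.

Definition cone_vars (i : 'I_6) : T :=
  nth 0 [:: Y 0 * Y 1; Y 0 ^+ 2; - Y 1 ^+ 2; Y 2; Y 3; Y 4] i.

(* The parametrization of the cone [quad = 0] by [(s t, s^2, -t^2)]. *)
Definition cone_map : P -> {poly T} := graded_map (@mpolyC 5 k) cone_vars.
HB.instance Definition _ := GRing.RMorphism.on cone_map.

Lemma cone_map_var i : (i < 6)%N ->
  cone_map (X i) = (nth 0 [:: Y 0 * Y 1; Y 0 ^+ 2; - Y 1 ^+ 2; Y 2; Y 3; Y 4] i)%:P * 'X.
Proof. by move=> i6; rewrite /cone_map graded_map_var /cone_vars inordK. Qed.

Lemma cone_map_quad : cone_map quad = 0.
Proof.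
rewrite /quad rmorphD rmorphXn rmorphM /= !cone_map_var //=.
by rewrite polyCN !polyCM; ring.
Qed.

Definition cone_exp (m : 'X_{1..6}) : 'X_{1..5} :=
  [multinom nth 0%N [:: m (inord 0) + m (inord 1) + m (inord 1);
     m (inord 0) + m (inord 2) + m (inord 2); m (inord 3); m (inord 4); m (inord 5)] i
   | i < 5].

(** The parity of the exponent of s determines the exponent of x11 when this is 0 or 1; the
    exponents of x12 and x21 follow. *)
Lemma cone_exp_inj (m m' : 'X_{1..6}) :
  (m (inord 0%N) <= 1)%N -> (m' (inord 0%N) <= 1)%N -> cone_exp m = cone_exp m' -> m = m'.
Proof.
move=> h h' /mnmP E; apply/mnmP.
have E0 := E (inord 0); have E1 := E (inord 1); have E2 := E (inord 2).
have E3 := E (inord 3); have E4 := E (inord 4).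
rewrite !mnmE !inordK //= in E0 E1 E2 E3 E4.
by apply: forall_ord6 => //; lia.
Qed.

Lemma cone_vars_monom m : mmap1 cone_vars m = (-1) ^+ m (inord 2) * 'X_[cone_exp m].
Proof.
rewrite mpolyXE_id /mmap1.
have E6 (F : 'I_6 -> T) : \prod_i F i =
    F (inord 0) * F (inord 1) * F (inord 2) * F (inord 3) * F (inord 4) * F (inord 5).
  rewrite !big_ord_recl big_ord0 mulr1 !mulrA.
  by do ?[congr (_ * _)]; congr (F _); apply: val_inj; rewrite /= inordK.
have E5 (F : 'I_5 -> T) : \prod_i F i =
    F (inord 0) * F (inord 1) * F (inord 2) * F (inord 3) * F (inord 4).
  rewrite !big_ord_recl big_ord0 mulr1 !mulrA.
  by do ?[congr (_ * _)]; congr (F _); apply: val_inj; rewrite /= inordK.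
rewrite E6 E5 /cone_vars !mnmE !inordK //=.
have -> : - Y 1 ^+ 2 = (-1) * (Y 1 * Y 1) by ring.
by rewrite !exprD !exprMn; ring.
Qed.

(** Division by [quad], monic in x11: replace x11^2 by - x12 x21 until no monomial is divisible by
    x11^2. *)
Lemma quad_reduction (f : P) : exists u h,
  (forall m, m \in msupp u -> (m (inord 0%N) <= 1)%N) /\ f = u + quad * h.
Proof.
elim/mpolyind: f => [|c m f _ _ [u [h [hu ->]]]].
  by exists 0, 0; split; [move=> m; rewrite msupp0|ring].
suff [u' [h' [hu' ->]]] : exists u' h', (forall m, m \in msupp u' -> (m (inord 0%N) <= 1)%N)
    /\ 'X_[m] = u' + quad * h' :> P.
  exists (c *: u' + u), (c *: h' + h); split; last by rewrite -!mul_mpolyC; ring.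
  move=> d /msuppD_le; rewrite mem_cat => /orP[/msuppZ_le|]; [exact: hu'|exact: hu].
have [e] := ubnP (m (inord 0)); elim: e m => [//|e IH] m le.
have [m1|m1] := leqP (m (inord 0)) 1.
  by exists 'X_[m], 0; split; [move=> d; rewrite msuppX inE => /eqP->|rewrite mulr0 addr0].
pose U i : 'X_{1..6} := U_(inord i)%MM.
pose m' : 'X_{1..6} := (m - U 0%N - U 0%N)%MM.
have mE : m = (U 0%N + U 0%N + m')%MM.
  apply/mnmP => i; rewrite !mnmDE !mnmBE !mnm1E.
  by case: (inord 0 =P i) => [<-|_]; lia.
have [|u' [h' [hu' E]]] := IH (U 1%N + U 2%N + m')%MM.
  by rewrite !mnmDE !mnmBE !mnm1E -!val_eqE /= !inordK //=; lia.
exists (- u'), ('X_[m'] - h'); split=> [d|]; first by rewrite (perm_mem (msuppN _)); apply: hu'.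
have -> : 'X_[m] = X 0 ^+ 2 * 'X_[m'] :> P by rewrite {1}mE !mpolyXD expr2.
by apply/(addrI 'X_[U 1%N + U 2%N + m']); rewrite {2}E !mpolyXD /quad; ring.
Qed.

(** The remainder modulo [quad] is a combination of reduced monomials, whose images are distinct
    monomials up to sign; nothing cancels, so the order of the remainder can be read off its
    image. *)
Lemma pord_cone_map N f : pord N (cone_map f) <-> quad_ideal N f.
Proof.
split; last first.
  case=> h [r [hr ->]]; rewrite rmorphD rmorphM /= cone_map_quad mul0r add0r.
  exact: pord_graded_map.
have [u [h [hu ->]]] := quad_reduction f.
rewrite rmorphD rmorphM /= cone_map_quad mul0r addr0 => ho.
exists h, u; split; last by rewrite addrC.
move=> m hm; have := ho _ hm; rewrite coef_graded_map => /(congr1 (mcoeff (cone_exp m))).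
rewrite mcoeff0 raddf_sum /=.
have [ms|/memN_msupp_eq0//] := boolP (m \in msupp u).
have cE d : ((u@_d)%:MP * mmap1 cone_vars d)@_(cone_exp m) =
   u@_d * (-1) ^+ d (inord 2) * (cone_exp d == cone_exp m)%:R.
  have -> : (u@_d)%:MP * mmap1 cone_vars d =
      (u@_d * (-1) ^+ d (inord 2))%:MP * 'X_[cone_exp d] :> T.
    by rewrite cone_vars_monom rmorphM rmorph_sign mulrA.
  by rewrite mcoeffCM mcoeffX.
rewrite -big_filter (bigD1_seq m) ?filter_uniq ?msupp_uniq //=; last first.
  by rewrite mem_filter eqxx.
rewrite cE eqxx mulr1 big_seq_cond big1 ?addr0; last first.
  move=> d /andP[]; rewrite mem_filter => /andP[_ ds] nd; rewrite cE.
  case: eqP => [E|_]; last by rewrite mulr0.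
  by case/eqP: nd; apply: cone_exp_inj E; apply: hu.
by move=> /eqP; rewrite mulf_eq0 signr_eq0 orbF => /eqP.
Qed.
End Cone.

Lemma mul_sub_split (R : comPzRingType) (g h g' h' : R) :
  g * h - g' * h' = g * (h - h') + h' * (g - g').
Proof. by ring. Qed.

Lemma mpoly_morph_congr (k : fieldType) n (G : {lrmorphism {mpoly k[n]} -> {mpoly k[n]}})
    (J : {mpoly k[n]} -> Prop) : is_ideal J ->
  (forall i, J ('X_i - G 'X_i)) -> forall f, J (f - G f).
Proof.
case=> J0 JD JM JX f.
have S1 : J (1 - G 1) by rewrite rmorph1 subrr.
have SM g h : J (g - G g) -> J (h - G h) -> J (g * h - G (g * h)).
  by move=> Jg Jh; rewrite rmorphM mul_sub_split; apply: JD; apply: JM.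
elim/mpolyind: f => [|c m f _ _ Jf]; first by rewrite linear0 subrr.
rewrite linearP opprD addrACA -scalerBr; apply: JD => //.
rewrite -mul_mpolyC; apply: JM; rewrite mpolyXE_id.
elim/big_rec: _ => // i g _ Jg; apply: (SM) => //.
by elim: (m i) => [|e IH]; rewrite ?expr0 // exprS; apply: SM.
Qed.

(** * Quotients that are polynomial rings in fewer variables *)

Section Retract.
Variables (k : fieldType) (n r : nat).
Variables (lq : n.-tuple {mpoly k[r]}) (lr : r.-tuple {mpoly k[n]}).

Lemma comp_mpoly_congr (J : {mpoly k[n]} -> Prop) : is_ideal J ->
  (forall i, J ('X_i - ((tnth lq i) \mPo lr))) ->
  forall f, J (f - ((f \mPo lq) \mPo lr)).
Proof.
move=> idJ JX; apply: (mpoly_morph_congr (G := comp_mpoly lr \o comp_mpoly lq) idJ) => i.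
by rewrite /= comp_mpolyXU -tnth_nth.
Qed.

Lemma ordge_comp N f : (forall i, ordge 1 (tnth lq i)) ->
  ordge N f -> ordge N (f \mPo lq).
Proof.
move=> hq hf; rewrite comp_mpolyEX big_seq.
apply: (big_ind (ordge N)) => [||m ms]; [exact: ordge0|exact: ordgeD|].
have Nm : (N <= mdeg m)%N.
  by rewrite leqNgt; apply/negP => /hf /eqP; rewrite mcoeff_eq0 ms.
rewrite -mul_mpolyC; apply: ordgeMl; rewrite comp_mpolyX => d hd.
have: ordge (\sum_(i < n) m i) (\prod_(i < n) tnth lq i ^+ m i).
  elim/big_rec2: _ => [|i e g _ hg]; first exact: ordge_ge0.
  by apply: ordgeM => //; apply: ordgeXn.
by rewrite -mdegE; apply; apply: leq_trans hd Nm.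
Qed.

End Retract.

Lemma comp_mpoly_retract (k : fieldType) n r (lq : n.-tuple {mpoly k[r]})
    (lr : r.-tuple {mpoly k[n]}) :
  (forall i, (tnth lr i) \mPo lq = 'X_i) -> forall g, (g \mPo lr) \mPo lq = g.
Proof.
move=> h g; apply/eqP; rewrite eq_sym -subr_eq0; apply/eqP.
apply: (@comp_mpoly_congr k r n lr lq (fun f => f = 0)) => [|i].
  split=> // [x y -> ->|x y ->]; [exact: addr0|exact: mulr0].
by rewrite h subrr.
Qed.

(** The substitution [lq] has the section [lr], and modulo J a polynomial equals its image under the
    round trip; so J is the preimage of [ordge N] under a surjection. *)
Lemma codim_retract (k : fieldType) n r (lq : n.-tuple {mpoly k[r]})
    (lr : r.-tuple {mpoly k[n]}) (J : {mpoly k[n]} -> Prop) N d :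
  is_ideal J -> (forall f, ordge N f -> J f) ->
  (forall f, J f -> ordge N (f \mPo lq)) ->
  (forall i, ordge 1 (tnth lr i)) ->
  (forall i, (tnth lr i) \mPo lq = 'X_i) ->
  (forall i, J ('X_i - ((tnth lq i) \mPo lr))) ->
  codim (@ordge k r N) d -> codim J d.
Proof.
move=> idJ JN Jq hr rq qr cd.
apply: (eq_codim _ (codim_preim (f := comp_mpoly lq) _ cd)) => [f|g]; last first.
  by exists (g \mPo lr); apply: comp_mpoly_retract.
split=> /= [h|]; last exact: Jq.
rewrite -[f](subrK ((f \mPo lq) \mPo lr)); have [J0 JD JM] := idJ.
apply: JD; first exact: comp_mpoly_congr.
by apply: JN; apply: ordge_comp.
Qed.

Section ConeCodim.
Variables (k : fieldType) (b : k).
Local Notation P := {mpoly k[6]}.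
Local Notation T := {mpoly k[5]}.
Local Notation X i := ('X_(inord i : 'I_6) : P).
Local Notation Y i := ('X_(inord i : 'I_5) : T).
Local Notation Z i := ('X_(inord i : 'I_3) : {mpoly k[3]}).

(** Multiplication by [quad] shifts the order by exactly 2; in [codim_add_image], U is the whole
    ring and the third codimension is 0. *)
Lemma codim_quad_ideal M :
  codim (@quad_ideal k M.+3) ('C(6 + M.+2, 6) - 'C(6 + M, 6)).
Proof.
have : codim (fun f => exists u y, [/\ True, ordge M.+3 y & f = mulby (quad k) u + y])
    ('C(6 + M.+2, 6) - ('C(6 + M, 6) - 0)).
  apply: (codim_add_image (J' := ordge M.+1) (U := fun=> True)) => //;
    [|exact: codim_ordge|exact: codim_ordge|]; last first.
    apply: eq_codim (codimT P) => f; split=> // _.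
    by exists f, 0; split=> //; [exact: ordge0|rewrite addr0].
  move=> u _; rewrite -!pord_id_graded_map /mulby rmorphM /=.
  have -> : (M.+3 = M.+1 + 2)%N by rewrite addn2.
  have E : graded_map (@mpolyC 6 k) (fun i => 'X_i) (quad k) = (quad k)%:P * 'X^2.
    rewrite /quad rmorphD rmorphXn rmorphM /= !graded_map_var polyCD !polyCM; ring.
  apply: pordM; first by move=> d d2; rewrite E coefMXn d2.
  rewrite E coefMXn coefC /=; apply/eqP => /(congr1 (mcoeff (U_(inord 0) *+ 2)%MM)).
  rewrite mcoeff0 mcoeffD mpolyXn -mpolyXD !mcoeffX eqxx.
  have -> : (U_(inord 1) + U_(inord 2) == U_(inord 0) *+ 2 :> 'X_{1..6})%MM = false.
    apply/eqP => /mnmP /(_ (inord 0)).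
    by rewrite mnmDE mulmnE !mnm1E -!val_eqE /= !inordK.
  by rewrite addr0 => /eqP; rewrite oner_eq0.
rewrite subn0; apply: eq_codim => f; split.
  by case=> h [r [_ hr ->]]; exists h, r.
by case=> h [r [hr ->]]; exists h, r.
Qed.

(** The ideal of the vertex locus x11 = x12 = x21 = 0 of the cone. *)
Definition vertex_ideal (f : P) := exists h0 h1 h2, f = h0 * X 0 + h1 * X 1 + h2 * X 2.

(** Since [quad] vanishes on the vertex, only the three y variables survive, truncated at order M +
    1. *)
Lemma codim_vertex_ideal M :
  codim (fun f => exists u y, [/\ vertex_ideal u, @quad_ideal k M.+1 y & f = u + y])
    'C(3 + M, 3).
Proof.
pose lq := [tuple 0; 0; 0; Z 0; Z 1; Z 2] : 6.-tuple {mpoly k[3]}.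
pose lr := [tuple X 3; X 4; X 5] : 3.-tuple P.
have lqE i (i6 : (i < 6)%N) : tnth lq (inord i) = [:: 0; 0; 0; Z 0; Z 1; Z 2]`_i.
  by rewrite (tnth_nth 0) inordK.
have Xq i : (i < 6)%N -> X i \mPo lq = [:: 0; 0; 0; Z 0; Z 1; Z 2]`_i.
  by move=> i6; rewrite comp_mpolyXU inordK.
have Zr i : (i < 3)%N -> Z i \mPo lr = [:: X 3; X 4; X 5]`_i.
  by move=> i3; rewrite comp_mpolyXU inordK.
apply: (@codim_retract _ _ _ lq lr _ M.+1); last exact: codim_ordge.
- split.
  + exists 0, 0; split; [exists 0, 0, 0; ring|exists 0, 0; split|ring]; last by ring.
    exact: ordge0.
  + move=> _ _ [_ [_ [[h0 [h1 [h2 ->]]] [q [r [hr ->]]] ->]]]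
      [_ [_ [[h0' [h1' [h2' ->]]] [q' [r' [hr' ->]]] ->]]].
    exists ((h0 + h0') * X 0 + (h1 + h1') * X 1 + (h2 + h2') * X 2).
    exists (quad k * (q + q') + (r + r')); split; last by ring.
      by exists (h0 + h0'), (h1 + h1'), (h2 + h2').
    by exists (q + q'), (r + r'); split=> //; apply: ordgeD.
  move=> c _ [_ [_ [[h0 [h1 [h2 ->]]] [q [r [hr ->]]] ->]]].
  exists ((c * h0) * X 0 + (c * h1) * X 1 + (c * h2) * X 2).
  exists (quad k * (c * q) + c * r); split; last by ring.
    by exists (c * h0), (c * h1), (c * h2).
  by exists (c * q), (c * r); split=> //; apply: ordgeMl.
- move=> f hf; exists 0, f; split; last by ring.
    by exists 0, 0, 0; ring.
  by exists 0, f; split=> //; ring.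
- move=> _ [_ [_ [[h0 [h1 [h2 ->]]] [q [r [hr ->]]] ->]]].
  rewrite /quad !(rmorphD, rmorphM, rmorphXn) /= !Xq //=.
  rewrite ?expr0n /= !(mulr0, mul0r, addr0, add0r).
  apply: ordge_comp => //; apply: forall_ord6; rewrite lqE //=;
    by [apply: ordge0|apply: ordge_var].
- by case=> -[|[|[|//]]] lt; apply: ordge_var.
- case=> -[|[|[|//]]] lt; have /= <- := inord_val (Ordinal lt);
    by rewrite (tnth_nth 0) inordK //= Xq.
apply: forall_ord6; rewrite lqE //= ?rmorph0 ?subr0 ?Zr //= ?subrr.
- exists (X 0), 0; split; last by ring.
    by exists 1, 0, 0; ring.
  by exists 0, 0; split; [exact: ordge0|ring].
- exists (X 1), 0; split; last by ring.
    by exists 0, 1, 0; ring.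
  by exists 0, 0; split; [exact: ordge0|ring].
- exists (X 2), 0; split; last by ring.
    by exists 0, 0, 1; ring.
  by exists 0, 0; split; [exact: ordge0|ring].
all: exists 0, 0; split; [by exists 0, 0, 0; ring| |by ring].
all: by exists 0, 0; split; [exact: ordge0|ring].
Qed.

Definition lform : P := X 2 * ry12 b + 2%:R * X 0 * X 3 + X 1 * X 5.

Definition lform_ord : nat := if b == 0 then 2 else 1.

(** On the cone the part of degree 1 is - b t^2; if b = 0, the part of degree 2 contains s^2 y21
    with coefficient 1. *)
Lemma cone_map_lform : pord lform_ord (cone_map lform) /\ (cone_map lform)`_lform_ord != 0.
Proof.
have E : cone_map lform =
    (- Y 1 ^+ 2 * Y 3 + 2%:R * (Y 0 * Y 1 * Y 2) + Y 0 ^+ 2 * Y 4)%:P * 'X^2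
    + (- (b%:MP * Y 1 ^+ 2))%:P * 'X.
  rewrite /lform /ry12 !(rmorphD, rmorphM, rmorph_nat) /= !cone_map_var //=.
  by rewrite /cone_map graded_mapC; ring.
rewrite /lform_ord E; case: eqVneq => [->|nb].
  rewrite mpolyC0 mul0r oppr0 polyC0 mul0r addr0.
  split=> [d d2|]; first by rewrite coefMXn d2.
  rewrite coefMXn /= coefC /=.
  apply/eqP => /(congr1 (mcoeff (U_(inord 0) *+ 2 + U_(inord 4))%MM)).
  rewrite mcoeff0 !mcoeffD mulNr mcoeffN mulr_natl mcoeffMn.
  rewrite !mpolyXn -!mpolyXD !mcoeffX eqxx.
  have ne (m m' : 'X_{1..5}) : m (inord 0) != m' (inord 0) -> (m == m') = false.
    by move=> h; apply/eqP => E'; rewrite E' eqxx in h.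
  rewrite !ne ?(mnmDE, mulmnE, mnm1E) -?val_eqE /= ?inordK //.
  by rewrite oppr0 mul0rn !add0r => /eqP; rewrite oner_eq0.
split=> [d|]; first by rewrite ltnS leqn0 => /eqP->; rewrite coefD coefMXn coefMX /= addr0.
rewrite coefD coefMXn coefMX /= add0r coefC /= oppr_eq0 mpolyXn mul_mpolyC.
apply/eqP => /(congr1 (mcoeff (U_(inord 1) *+ 2)%MM)).
by rewrite mcoeffZ mcoeffX eqxx mcoeff0 mulr1 => /eqP; apply/negP.
Qed.

(** At a = 0 one has rI1 = - q, rI2 = q y12 - l x12, rI3 = l x21 - q y21 and rI4 = l x11 - 2 q y11,
    with q and l for [quad] and [lform]. *)
Lemma res_ideal0E N (f : P) : res_ideal 0 b N f <->
  exists u y : P, [/\ vertex_ideal u, quad_ideal N y & f = lform * u + y].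
Proof.
rewrite /res_ideal /rI1 /rI2 /rI3 /rI4 /rx12 mpolyC0 addr0; split.
  case=> h1 [h2 [h3 [h4 [r [hr ->]]]]].
  exists (h4 * X 0 + (- h2) * X 1 + h3 * X 2).
  exists (quad k * (- h1 + h2 * ry12 b - h3 * X 5 - 2%:R * h4 * X 3) + r).
  split; [by exists h4, (- h2), h3| |by rewrite /lform /quad; ring].
  by exists (- h1 + h2 * ry12 b - h3 * X 5 - 2%:R * h4 * X 3), r.
move=> [_ [_ [[g0 [g1 [g2 ->]]] [h [r [hr ->]]] ->]]].
exists (- (h + g1 * ry12 b + g2 * X 5 + 2%:R * g0 * X 3)), (- g1), g2, g0, r.
by split=> //; rewrite /lform /quad; ring.
Qed.

(** Here N = K + 3 and N - e = M + 3. By [pordM], l u has order at least N on the cone exactly when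
    u has order at least N - e; this is what [codim_add_image] asks of multiplication by l on the
    vertex ideal. *)
Lemma codim_res_ideal0 M : let K := (M + lform_ord)%N in
  codim (res_ideal 0 b K.+3)
    ('C(6 + K.+2, 6) - 'C(6 + K, 6)
     - ('C(6 + M.+2, 6) - 'C(6 + M, 6) - 'C(3 + M.+2, 3))).
Proof.
move=> K; have [e1 e2] := cone_map_lform.
have cd := codim_add_image (mu := mulby lform) _ _ _
  (codim_quad_ideal K) (codim_quad_ideal M) (codim_vertex_ideal M.+2).
apply: eq_codim (cd _ _ _).
- by move=> f; apply: iff_sym; apply: res_ideal0E.
- by exists 0, 0, 0; ring.
- move=> t _ _ [g0 [g1 [g2 ->]]] [h0 [h1 [h2 ->]]].
  exists (t%:MP * g0 + h0), (t%:MP * g1 + h1), (t%:MP * g2 + h2).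
  by rewrite -mul_mpolyC; ring.
move=> u _; rewrite -!pord_cone_map /mulby rmorphM /= -!addSn.
exact: pordM.
Qed.

End ConeCodim.

(** * The smooth case *)

Section Smooth.
Variables (k : fieldType) (a b : k).
Local Notation P := {mpoly k[6]}.
Local Notation Q := {mpoly k[4]}.
Local Notation X i := ('X_(inord i : 'I_6) : P).
Local Notation Z i := ('X_(inord i : 'I_4) : Q).

(** A partial geometric sum inverts x12 up to order N, which suffices modulo [ordge N] and keeps the
    argument inside polynomials. *)
Lemma truncated_inverse N : a != 0 -> exists c : Q, ordge N ((Z 1 + a%:MP) * c - 1).
Proof.
move=> na; pose w : Q := - (a^-1)%:MP * Z 1.
exists ((a^-1)%:MP * \sum_(i < N) w ^+ i).
have aV : a%:MP * (a^-1)%:MP = 1 :> Q by rewrite -mpolyCM mulfV.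
have E : Z 1 + a%:MP = - a%:MP * (w - 1).
  have -> : - a%:MP * (w - 1) = a%:MP * (a^-1)%:MP * Z 1 + a%:MP by rewrite /w; ring.
  by rewrite aV mul1r.
have -> : (Z 1 + a%:MP) * ((a^-1)%:MP * \sum_(i < N) w ^+ i) - 1 = - w ^+ N.
  rewrite E; set S := \sum_(i < N) _.
  have -> : - a%:MP * (w - 1) * ((a^-1)%:MP * S) - 1 =
    - (a%:MP * (a^-1)%:MP * ((w - 1) * S)) - 1 by ring.
  by rewrite aV mul1r -subrX1 opprB addrAC subrr add0r.
by apply/ordgeN/ordgeXn => //; apply: ordgeMl; apply: ordge_var.
Qed.

(* The first and second relation are solved for [x21] and [y21]. *)
Lemma codim_res_ideal_elim N (c : Q) : ordge N.+1 ((Z 1 + a%:MP) * c - 1) ->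
  codim (res_ideal a b N.+1) 'C(4 + N, 4).
Proof.
move=> ec.
(* With [c] for 1 / x12: x21 = - x11^2 / x12 and y21 = x11^2 y12 / x12^2 - 2 x11 y11 / x12. *)
pose g2 : Q := - c * Z 0 ^+ 2.
pose g5 : Q := c ^+ 2 * Z 0 ^+ 2 * (Z 3 + b%:MP) - 2%:R * c * Z 0 * Z 2.
pose lq := [tuple Z 0; Z 1; g2; Z 2; Z 3; g5] : 6.-tuple Q.
pose lr := [tuple X 0; X 1; X 3; X 4] : 4.-tuple P.
have lqE i (i6 : (i < 6)%N) : tnth lq (inord i) = [:: Z 0; Z 1; g2; Z 2; Z 3; g5]`_i.
  by rewrite (tnth_nth 0) inordK.
have Xq i : (i < 6)%N -> X i \mPo lq = [:: Z 0; Z 1; g2; Z 2; Z 3; g5]`_i.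
  by move=> i6; rewrite comp_mpolyXU inordK.
have Zr i : (i < 4)%N -> Z i \mPo lr = [:: X 0; X 1; X 3; X 4]`_i.
  by move=> i4; rewrite comp_mpolyXU inordK.
have lr1 i : ordge 1 (tnth lr i).
  by case: i => -[|[|[|[|//]]]] lt; apply: ordge_var.
have lq1 i : ordge 1 (tnth lq i).
  move: i; apply: forall_ord6; rewrite lqE //=; do ?exact: ordge_var.
    by rewrite /g2 expr2 mulrA; apply: ordgeMl; apply: ordge_var.
  apply: ordgeD; last by apply/ordgeN/ordgeMl/ordge_var.
  by rewrite mulrC expr2 !mulrA; apply: ordgeMl; apply: ordge_var.
apply: (@codim_retract _ _ _ lq lr _ N.+1); last exact: codim_ordge.
- exact: res_ideal_is_ideal.
- exact: res_ideal_ordge.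
- move=> _ [h1 [h2 [h3 [h4 [r [hr ->]]]]]].
  rewrite !(comp_mpolyD, rmorphM) /=.
  (* After the substitution each relation is a multiple of x12 c - 1, hence of order at least N + 1;
     the third one vanishes identically. *)
  have E1 : rI1 a \mPo lq = Z 0 ^+ 2 * ((Z 1 + a%:MP) * c - 1).
    rewrite /rI1 /rx12 !(rmorphB, rmorphN, rmorphD, rmorphM, rmorphXn) /= comp_mpolyC !Xq //=.
    by rewrite /g2; ring.
  have E2 : rI2 a b \mPo lq = (- Z 0 ^+ 2 * (Z 3 + b%:MP) * (1 + (Z 1 + a%:MP) * c)
      + 2%:R * Z 0 * (Z 1 + a%:MP) * Z 2) * ((Z 1 + a%:MP) * c - 1).
    rewrite /rI2 /rx12 /ry12 !(rmorphB, rmorphN, rmorphD, rmorphM, rmorphXn, rmorph_nat) /=.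
    by rewrite !comp_mpolyC !Xq //= /g5; ring.
  have E3 : rI3 b \mPo lq = 0.
    rewrite /rI3 /ry12 !(rmorphB, rmorphN, rmorphD, rmorphM, rmorphXn, rmorph_nat) /=.
    by rewrite !comp_mpolyC !Xq //= /g2 /g5; ring.
  have E4 : rI4 a b \mPo lq = c * Z 0 ^+ 3 * (Z 3 + b%:MP) * ((Z 1 + a%:MP) * c - 1).
    rewrite /rI4 /rx12 /ry12 !(rmorphB, rmorphN, rmorphD, rmorphM, rmorphXn, rmorph_nat) /=.
    by rewrite !comp_mpolyC !Xq //= /g2 /g5; ring.
  rewrite E1 E2 E3 E4 mulr0 addr0.
  apply: ordgeD; last exact: ordge_comp.
  by apply: ordgeD; first apply: ordgeD; do 2!apply: ordgeMl.
- exact: lr1.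
- case=> -[|[|[|[|//]]]] lt; have /= <- := inord_val (Ordinal lt);
    by rewrite (tnth_nth 0) inordK //= Xq.
pose c' : P := c \mPo lr.
have ec' : ordge N.+1 ((X 1 + a%:MP) * c' - 1).
  have := ordge_comp lr1 ec.
  by rewrite !(rmorphB, rmorphD, rmorphM, rmorph1) /= comp_mpolyC Zr.
have F2 : g2 \mPo lr = - c' * X 0 ^+ 2.
  by rewrite /g2 !(rmorphN, rmorphM, rmorphXn) /= Zr.
have F5 : g5 \mPo lr = c' ^+ 2 * X 0 ^+ 2 * (X 4 + b%:MP) - 2%:R * c' * X 0 * X 3.
  rewrite /g5 !(rmorphB, rmorphN, rmorphD, rmorphM, rmorphXn, rmorph_nat) /=.
  by rewrite !comp_mpolyC !Zr.
move: c' ec' F2 F5 => c' ec' F2 F5; have [J0 _ _] := res_ideal_is_ideal a b N.+1.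
apply: forall_ord6; rewrite lqE //= ?F2 ?F5 ?Zr //= ?subrr //.
  exists (- c'), 0, 0, 0, (- X 2 * ((X 1 + a%:MP) * c' - 1)).
  by split; [apply: ordgeMl|rewrite /rI1 /rx12; ring].
exists 0, (- c' ^+ 2), 0, 0.
exists ((- (1 + (X 1 + a%:MP) * c') * X 5 - 2%:R * c' * X 0 * X 3) * ((X 1 + a%:MP) * c' - 1)).
by split; [apply: ordgeMl|rewrite /rI2 /rx12 /ry12; ring].
Qed.

Lemma codim_res_ideal_unit N : a != 0 -> codim (res_ideal a b N.+1) 'C(4 + N, 4).
Proof. by move=> /(truncated_inverse N.+1)[c]; apply: codim_res_ideal_elim. Qed.

End Smooth.

(** * Power series *)

Section SeriesOrder.
Variables (R : comNzRingType) (n : nat).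
Local Notation S := (mfps n R).

Definition sord N (f : S) := forall m, (mdeg m < N)%N -> fpscoef f m = 0.

Lemma fpscoefD (f g : S) m : fpscoef (f + g) m = fpscoef f m + fpscoef g m.
Proof. by []. Qed.

Lemma fpscoefN (f : S) m : fpscoef (- f) m = - fpscoef f m.
Proof. by []. Qed.

Lemma fpscoef_sum I (r : seq I) (p : pred I) (F : I -> S) m :
  fpscoef (\sum_(i <- r | p i) F i) m = \sum_(i <- r | p i) fpscoef (F i) m.
Proof. by elim/big_rec2: _ => // i x y _ <-. Qed.

Lemma fpscoefM (f g : S) m : fpscoef (f * g) m =
  \sum_(d : 'X_{1..n < (mdeg m).+1} | (d <= m)%MM) fpscoef f d * fpscoef g (m - d)%MM.
Proof. by []. Qed.

Lemma fpscoefCM c (f : S) m : fpscoef (mfps_const n c * f) m = c * fpscoef f m.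
Proof.
rewrite fpscoefM (bigD1 (bm0 : 'X_{1..n < (mdeg m).+1})) /=; last by apply/mnm_lepP => i; rewrite mnm0E.
rewrite eqxx big1 => [|d /andP[_]]; last first.
  by rewrite bmeqP /= => /negPf->; rewrite mul0r.
by rewrite addr0; congr (_ * fpscoef f _); apply/mnmP => i; rewrite mnmBE mnm0E subn0.
Qed.

Lemma fpscoef_varM i (f : S) m : fpscoef (mfps_var R i * f) m =
  if (0 < m i)%N then fpscoef f (m - U_(i))%MM else 0.
Proof.
rewrite fpscoefM; case: ifP => [mi|/negbT mi].
  have U_m : (mdeg (U_(i)%MM : 'X_{1..n}) < (mdeg m).+1)%N.
    rewrite mdeg1 ltnS lt0n mdeg_eq0; apply: contraTneq mi => ->.
    by rewrite mnm0E.
  rewrite (bigD1 (BMultinom U_m)) /=; last first.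
    by apply/mnm_lepP => j; rewrite mnm1E; case: eqP => // <-.
  rewrite eqxx mul1r big1 ?addr0 // => d /andP[_].
  by rewrite bmeqP /= => /negPf->; rewrite mul0r.
rewrite big1 // => d /mnm_lepP/(_ i) di /=; case: eqP => [E|_]; last by rewrite mul0r.
by move: di; rewrite E mnm1E eqxx; case: (m i) mi.
Qed.

Lemma sordM a b (f g : S) : sord a f -> sord b g -> sord (a + b) (f * g).
Proof.
move=> hf hg m hm; rewrite fpscoefM big1 // => d dm.
have [ha|ha] := ltnP (mdeg d) a; first by rewrite hf ?mul0r.
rewrite hg ?mulr0 // -(ltn_add2l (mdeg d)) -mdegD addmC submK //.
by apply: leq_trans hm _; rewrite leq_add2r.
Qed.

Lemma sordXn (f : S) e : sord 1 f -> sord e (f ^+ e).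
Proof. by move=> hf; elim: e => [//|e IH]; rewrite exprS; apply: (sordM hf IH). Qed.

(** At a monomial of degree d the partial sums of the geometric series are stationary from d + 1
    terms on; this value is taken as the coefficient. *)
Lemma mfps_geometric_inverse (h : S) : sord 1 h -> exists g, (1 - h) * g = 1.
Proof.
move=> hh; pose G N := \sum_(i < N) h ^+ i.
exists (MFps (fun m => fpscoef (G (mdeg m).+1) m)).
have GE N d : (mdeg d < N)%N -> fpscoef (G (mdeg d).+1) d = fpscoef (G N) d.
  move=> dN; rewrite -(subnKC dN) {2}/G big_split_ord fpscoefD.
  rewrite [X in _ = _ + X]fpscoef_sum [X in _ = _ + X]big1 ?addr0 // => i _.
  by apply: (sordXn hh); rewrite /= addSn ltnS leq_addr.
apply: mfpsP => m.
have E : 1 = (1 - h) * G (mdeg m).+1 + h ^+ (mdeg m).+1 :> S.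
  by rewrite -[(1 - h)]opprB mulNr -subrX1 opprB subrK.
rewrite [in RHS]E fpscoefD (sordXn hh (ltnSn _)) addr0 !fpscoefM.
by apply: eq_bigr => d dm /=; rewrite (GE (mdeg m).+1) // ltnS mdegB.
Qed.

(** Each monomial of positive degree is charged to the first variable that divides it. *)
Lemma sord_decomp N (w : S) : sord N.+1 w ->
  exists u : 'I_n -> S, (forall i, sord N (u i)) /\ w = \sum_i mfps_var R i * u i.
Proof.
move=> hw.
pose first (i : 'I_n) (m : 'X_{1..n}) := [forall j : 'I_n, (j < i)%N ==> (m j == 0%N)].
exists (fun i => MFps (fun m => if first i m then fpscoef w (m + U_(i))%MM else 0)).
split=> [i m hm /=|]; first by case: ifP => // _; rewrite hw // mdegD mdeg1 addn1 ltnS.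
apply: mfpsP => m; rewrite fpscoef_sum.
under eq_bigr do rewrite fpscoef_varM /=.
have [->|nm] := eqVneq m 0%MM.
  by rewrite hw ?mdeg0 // big1 // => i _; rewrite mnm0E.
have [i0 hi0] : exists i, (0 < m i)%N.
  apply/existsP; apply: contraNT nm; rewrite negb_exists => /forallP h.
  by apply/eqP/mnmP => i; rewrite mnm0E; have := h i; rewrite -eqn0Ngt => /eqP.
case: (@arg_minnP _ i0 (fun i => 0 < m i)%N (fun i => val i) hi0) => i hi imin.
have zero (j : 'I_n) : (j < i)%N -> m j = 0%N.
  by move=> ji; apply/eqP; rewrite -leqn0 leqNgt; apply: contraL ji => /imin; rewrite -leqNgt.
rewrite (bigD1 i) //= hi [X in if X then _ else _](_ : first i _ = true); last first.
  apply/forallP => j; apply/implyP => ji; rewrite mnmBE zero //.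
have -> : (m - U_(i) + U_(i))%MM = m.
  by apply/mnmP => j; rewrite mnmDE mnmBE mnm1E; case: eqP => [<-|_]; rewrite ?subn0 ?addn0 // subnK.
rewrite big1 ?addr0 // => j ji; case: ifP => // mj; case: ifP => // /forallP/(_ i).
have ij : (i < j)%N by rewrite ltn_neqAle imin // andbT eq_sym.
rewrite ij /= mnmBE mnm1E (negPf ji) subn0 => /eqP E.
by rewrite E in hi.
Qed.

End SeriesOrder.

Lemma ideal_power0 (A : comPzRingType) (m : A -> Prop) x : ideal_power m 0 x.
Proof.
exists 1%N, (fun=> x), (fun _ _ => 0); split=> [i []//|].
by rewrite big_ord1 big_ord0 mulr1.
Qed.

Lemma ideal_powerD (A : comPzRingType) (m : A -> Prop) N x y :
  ideal_power m N x -> ideal_power m N y -> ideal_power m N (x + y).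
Proof.
move=> [r [a [g [mg ->]]]] [r' [a' [g' [mg' ->]]]].
exists (r + r')%N, (fun i => match split i with inl i => a i | inr i => a' i end).
exists (fun i => match split i with inl i => g i | inr i => g' i end).
split=> [i j|]; first by case: split.
rewrite big_split_ord /=; congr (_ + _); apply: eq_bigr => i _.
  by rewrite (unsplitK (inl i)).
by rewrite (unsplitK (inr i)).
Qed.

Lemma ideal_power_zero (A : comPzRingType) (m : A -> Prop) N : ideal_power m N 0.
Proof. by exists 0%N, (fun=> 0), (fun _ _ => 0); split=> [[]//|]; rewrite big_ord0. Qed.

Lemma ideal_powerM (A : comPzRingType) (m : A -> Prop) N x y :
  m y -> ideal_power m N x -> ideal_power m N.+1 (y * x).
Proof.
move=> my [r [a [g [mg ->]]]].
exists r, a, (fun i j => if unlift ord0 j is Some j' then g i j' else y).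
split=> [i j|]; first by case: unlift.
rewrite mulr_sumr; apply: eq_bigr => i _.
rewrite big_ord_recl unlift_none mulrCA; congr (_ * (_ * _)).
by apply: eq_bigr => j _; rewrite liftK.
Qed.

(** * The ring R/pi, its maximal ideal and the powers of that ideal *)

Section Presentation.
Variables (k : fieldType) (O : idomainType) (res : {rmorphism O -> k}) (pi : O).
Hypothesis kerP : forall x, res x = 0 <-> exists y, x = pi * y.
Variable T : k -> O.
Hypothesis resT : forall t, res (T t) = t.
Variables (v al be : O).
Hypothesis res_v : res v = 0.

Local Notation S := (mfps 6 O).
Local Notation P := {mpoly k[6]}.
Local Notation C c := (mfps_const 6 c).
Local Notation V i := (mfps_var O (inord i : 'I_6)).
Local Notation X i := ('X_(inord i : 'I_6) : P).
Local Notation J := (res_ideal (res al) (res be)).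
Local Notation gens := [:: I1 v al; I2 v al be; I3 v be; I4 v al be].
Local Notation Rpi := (def_ring_mod_pi v al be pi).

Definition red N (f : S) : P := \sum_(m : 'X_{1..6 < N}) res (fpscoef f m) *: 'X_[m].

Lemma mcoeff_red N f m : (mdeg m < N)%N -> (red N f)@_m = res (fpscoef f m).
Proof. by move=> mN; rewrite (mcoeff_mpoly (fun m => res (fpscoef f m))). Qed.

Lemma redD N f g : red N (f + g) = red N f + red N g.
Proof.
rewrite /red -big_split /=; apply: eq_bigr => m _.
by rewrite rmorphD scalerDl.
Qed.

Lemma red0 N : red N 0 = 0.
Proof. by rewrite /red big1 // => m _; rewrite rmorph0 scale0r. Qed.

Lemma redN N f : red N (- f) = - red N f.
Proof. by apply/eqP; rewrite -addr_eq0 -redD addNr red0. Qed.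

(** [red N] is additive, but multiplicative only up to order N; this relation is stable under sums
    and products, so series can be reduced factor by factor. *)
Definition represents N (f : S) (p : P) := ordge N (red N f - p).

Lemma representsP N f p : represents N f p <->
  forall m, (mdeg m < N)%N -> res (fpscoef f m) = p@_m.
Proof.
split=> h m mN; have := h m mN.
  by rewrite mcoeffB mcoeff_red // => /eqP; rewrite subr_eq0 => /eqP.
by rewrite mcoeffB mcoeff_red // => ->; rewrite subrr.
Qed.

Lemma represents_red N f : represents N f (red N f).
Proof. by apply/representsP => m mN; rewrite mcoeff_red. Qed.

Lemma representsD N f g p q : represents N f p -> represents N g q ->
  represents N (f + g) (p + q).
Proof.
move=> /representsP hf /representsP hg; apply/representsP => m mN.
by rewrite fpscoefD rmorphD hf // hg // mcoeffD.
Qed.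

Lemma representsN N f p : represents N f p -> represents N (- f) (- p).
Proof.
move=> /representsP hf; apply/representsP => m mN.
by rewrite fpscoefN rmorphN hf // mcoeffN.
Qed.

Lemma representsM N f g p q : represents N f p -> represents N g q ->
  represents N (f * g) (p * q).
Proof.
move=> /representsP hf /representsP hg; apply/representsP => m mN.
rewrite fpscoefM (@mcoeff_poly_mul_lin _ _ p q m (mdeg m).+1) // rmorph_sum /=.
apply: eq_bigr => d dm; rewrite rmorphM hf ?hg //.
  by apply: leq_ltn_trans mN; apply: mdegB.
by apply: leq_ltn_trans mN; rewrite -ltnS bmdeg.
Qed.

Lemma representsC N c : represents N (C c) (res c)%:MP.
Proof.
apply/representsP => m mN /=; rewrite mcoeffC.
by case: eqP; rewrite ?mulr1 ?mulr0 // rmorph0.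
Qed.

Lemma represents_var N i : represents N (mfps_var O i) 'X_i.
Proof.
apply/representsP => m mN /=; rewrite mcoeffX eq_sym.
by case: eqP; rewrite ?rmorph1 ?rmorph0.
Qed.

Lemma representsXn N f p e : represents N f p -> represents N (f ^+ e) (p ^+ e).
Proof.
move=> h; elim: e => [|e IH]; last by rewrite !exprS; apply: representsM.
by have := @representsC N 1; rewrite rmorph1 mpolyC1.
Qed.

Lemma represents_nat N e : represents N e%:R e%:R.
Proof.
elim: e => [|e IH]; first by apply/representsP => m mN; rewrite mcoeff0 rmorph0.
rewrite !mulrSr; apply: (representsD IH).
by have := @representsC N 1; rewrite rmorph1 mpolyC1.
Qed.

Lemma represents_x11 N : represents N (x11 O) (X 0).
Proof. exact: represents_var. Qed.

Lemma represents_x12 N : represents N (x12 al) (rx12 (res al)).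
Proof. exact (representsD (@represents_var N _) (@representsC N _)). Qed.

Lemma represents_y12 N : represents N (y12 be) (ry12 (res be)).
Proof. exact (representsD (@represents_var N _) (@representsC N _)). Qed.

Lemma represents_v_plus N : represents N (C v + x11 O) (X 0).
Proof.
rewrite -[X 0]add0r; apply: representsD (@represents_x11 N).
by have := @representsC N v; rewrite res_v mpolyC0.
Qed.

Lemma represents_v_minus N : represents N (C v - x11 O) (- X 0).
Proof.
rewrite -[- X 0]add0r; apply: representsD (representsN (@represents_x11 N)).
by have := @representsC N v; rewrite res_v mpolyC0.
Qed.

Local Notation rD := representsD.
Local Notation rN := representsN.
Local Notation rM := representsM.
Local Notation rX := representsXn.

Lemma represents_I1 N : represents N (I1 v al) (rI1 (res al)).
Proof.
have -> : rI1 (res al) = X 0 * - X 0 - rx12 (res al) * X 2 by rewrite /rI1; ring.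
exact (rD (rM (@represents_v_plus N) (@represents_v_minus N))
  (rN (rM (@represents_x12 N) (@represents_var N _)))).
Qed.

Lemma represents_I2 N : represents N (I2 v al be) (rI2 (res al) (res be)).
Proof.
exact (rD (rD (rM (rX 2 (@represents_v_plus N)) (@represents_y12 N))
  (rN (rM (rM (rM (@represents_nat N 2) (@represents_v_plus N)) (@represents_x12 N))
    (@represents_var N _))))
  (rN (rM (rX 2 (@represents_x12 N)) (@represents_var N _)))).
Qed.

Lemma represents_I3 N : represents N (I3 v be) (rI3 (res be)).
Proof.
have -> : rI3 (res be) = X 2 ^+ 2 * ry12 (res be)
   - 2%:R * X 2 * (- X 0) * X 3 - (- X 0) ^+ 2 * X 5 by rewrite /rI3; ring.
exact (rD (rD (rM (rX 2 (@represents_var N _)) (@represents_y12 N))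
  (rN (rM (rM (rM (@represents_nat N 2) (@represents_var N _)) (@represents_v_minus N))
    (@represents_var N _))))
  (rN (rM (rX 2 (@represents_v_minus N)) (@represents_var N _)))).
Qed.

Lemma represents_I4 N : represents N (I4 v al be) (rI4 (res al) (res be)).
Proof.
have -> : rI4 (res al) (res be) = X 0 * X 2 * ry12 (res be)
   - 2%:R * rx12 (res al) * X 2 * X 3 - rx12 (res al) * (- X 0) * X 5 by rewrite /rI4; ring.
exact (rD (rD (rM (rM (@represents_v_plus N) (@represents_var N _)) (@represents_y12 N))
  (rN (rM (rM (rM (@represents_nat N 2) (@represents_x12 N)) (@represents_var N _))
    (@represents_var N _))))
  (rN (rM (rM (@represents_x12 N) (@represents_v_minus N)) (@represents_var N _)))).
Qed.

Definition lift_poly (p : P) : S := MFps (fun m => T p@_m).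

Lemma represents_lift N p : represents N (lift_poly p) p.
Proof. by apply/representsP => m _ /=; rewrite resT. Qed.

Definition proj (f : S) : Rpi :=
  to_quot [:: def_ring_const v al be pi] (to_quot gens f).

Lemma proj_surj (x : Rpi) : exists f, proj f = x.
Proof.
exists (repr (repr (x : Quotient.quot _) : Quotient.quot _)).
by rewrite /proj !to_quotK.
Qed.

Lemma projD f g : proj (f + g) = proj f + proj g.
Proof. by rewrite /proj !to_quotD. Qed.

Lemma projM f g : proj (f * g) = proj f * proj g.
Proof. by rewrite /proj !to_quotM. Qed.

Lemma proj_one : proj 1 = 1.
Proof. by []. Qed.

Lemma proj0P f : proj f = 0 <-> exists h1 h2 h3 h4 h,
  f = h1 * I1 v al + h2 * I2 v al be + h3 * I3 v be + h4 * I4 v al be + C pi * h.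
Proof.
have q0 (A : comPzRingType) (s : seq A) x : to_quot s x = 0 <-> x \in fg_ideal s.
  have -> : (0 : ring_quot s) = to_quot s 0.
    by apply: (addrI (to_quot s 0)); rewrite -to_quotD !addr0.
  by rewrite to_quot_eq subr0.
split.
  move/q0/asboolP => [c]; rewrite big_ord1 /=.
  have [c' <-] : exists c', to_quot gens c' = c ord0.
    by exists (repr (c ord0 : Quotient.quot _)); rewrite to_quotK.
  rewrite [_ * _](_ : _ = to_quot gens (c' * C pi)); last by rewrite to_quotM.
  move=> /to_quot_eq/asboolP[d].
  rewrite !big_ord_recl big_ord0 /= addr0 => E.
  do 4!eexists; exists c'; rewrite (mulrC (C pi)).
  by rewrite -[f](subrK (c' * C pi)) E !addrA.
move=> [h1 [h2 [h3 [h4 [h ->]]]]]; apply/q0/asboolP.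
exists (fun=> to_quot gens h); rewrite big_ord1 /=.
rewrite [RHS](_ : _ = to_quot gens (h * C pi)); last by rewrite to_quotM.
apply/to_quot_eq; rewrite (mulrC (C pi)) addrK; apply/asboolP.
exists (fun i : 'I_4 => [:: h1; h2; h3; h4]`_i).
by rewrite !big_ord_recl big_ord0 /= addr0 !addrA.
Qed.

Lemma projB f g : proj (f - g) = proj f - proj g.
Proof. by apply: (addIr (proj g)); rewrite -projD !subrK. Qed.

Lemma proj_sum I (r : seq I) (F : I -> S) :
  proj (\sum_(i <- r) F i) = \sum_(i <- r) proj (F i).
Proof.
apply: (big_morph proj projD); apply/proj0P; exists 0, 0, 0, 0, 0.
by rewrite !mul0r mulr0 !addr0.
Qed.

Lemma proj_prod I (r : seq I) (F : I -> S) :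
  proj (\prod_(i <- r) F i) = \prod_(i <- r) proj (F i).
Proof. exact: (big_morph proj projM proj_one). Qed.

Lemma res_ideal_represents N f p : represents N f p -> J N p <-> J N (red N f).
Proof.
have [J0 JD JM] := res_ideal_is_ideal (res al) (res be) N.
move=> h; split=> Jp.
  rewrite -[red N f](subrK p); apply: JD Jp; exact: res_ideal_ordge.
rewrite -[p](subrK (red N f)); apply: JD Jp; apply: res_ideal_ordge.
by rewrite -opprB; apply: ordgeN.
Qed.

Lemma proj0_res_ideal N f : proj f = 0 -> J N (red N f).
Proof.
move=> /proj0P[h1 [h2 [h3 [h4 [h ->]]]]].
set p := red N h1 * rI1 (res al) + red N h2 * rI2 (res al) (res be)
  + red N h3 * rI3 (res be) + red N h4 * rI4 (res al) (res be) + 0 * red N h.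
have rpi : res pi = 0 by apply/kerP; exists 1; rewrite mulr1.
have Cpi : represents N (C pi) 0 by have := @representsC N pi; rewrite rpi mpolyC0.
have hp : represents N (h1 * I1 v al + h2 * I2 v al be + h3 * I3 v be
    + h4 * I4 v al be + C pi * h) p.
  exact (rD (rD (rD (rD (rM (@represents_red N h1) (@represents_I1 N))
    (rM (@represents_red N h2) (@represents_I2 N)))
    (rM (@represents_red N h3) (@represents_I3 N)))
    (rM (@represents_red N h4) (@represents_I4 N))) (rM Cpi (@represents_red N h))).
apply/(res_ideal_represents hp).
exists (red N h1), (red N h2), (red N h3), (red N h4), (0 * red N h); split=> //.
by rewrite mul0r; apply: ordge0.
Qed.

Definition residue (f : S) : k := res (fpscoef f 0%MM).

Lemma fpscoef0M (f g : S) : fpscoef (f * g) 0%MM = fpscoef f 0%MM * fpscoef g 0%MM.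
Proof.
have u (d : 'X_{1..6 < (mdeg (0%MM : 'X_{1..6})).+1}) : val d = 0%MM.
  apply/eqP; rewrite -mdeg_eq0 -leqn0; have := bmdeg d.
  by rewrite ltnS => /leq_trans; apply; rewrite mdeg0.
rewrite fpscoefM (bigD1 bm0) /=; last by apply/mnm_lepP.
rewrite big1 ?addr0 => [|d /andP[_]]; last first.
  by rewrite bmeqP -[bmnm d]/(val d) u eqxx.
by rewrite [(0 - 0)%MM](_ : _ = 0%MM) //; apply/mnmP => i; rewrite mnmBE mnm0E.
Qed.

(** The four relations have zero constant term modulo pi, so the residue depends only on the class
    in R / pi. *)
Lemma residue_of_proj0 f : proj f = 0 -> residue f = 0.
Proof.
move=> /(@proj0_res_ideal 1)[h1 [h2 [h3 [h4 [r [hr E]]]]]].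
have -> : residue f = (red 1 f)@_0 by rewrite mcoeff_red ?mdeg0.
have ho i : ordge 1 (X i) by apply: ordge_var.
rewrite E; suff : ordge 1 (h1 * rI1 (res al) + h2 * rI2 (res al) (res be)
  + h3 * rI3 (res be) + h4 * rI4 (res al) (res be) + r) by apply; rewrite mdeg0.
have hX f1 i : ordge 1 (f1 * X i) by apply: ordgeMl.
apply: (ordgeD _ hr); apply: ordgeD; [apply: ordgeD; [apply: ordgeD|]|]; apply: ordgeMl.
- by apply: ordgeD (ordgeN (hX _ _)); apply: ordgeN; rewrite expr2.
- apply: ordgeD (ordgeN (hX _ _)); apply: ordgeD (ordgeN (hX _ _)).
  by rewrite mulrC expr2 mulrA.
- by apply: ordgeD (ordgeN (hX _ _)); apply: ordgeD (hX _ _); rewrite mulrC expr2 mulrA.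
- by apply: ordgeD (hX _ _); apply: ordgeD (ordgeN (hX _ _)); rewrite mulrC mulrA.
Qed.

Section MaximalIdeal.
Variable m : Rpi -> Prop.
Hypothesis m_max : is_maximal_ideal m.

(** Otherwise f would be invertible in R / pi: scaled to residue 1 it is, modulo pi, 1 minus a
    series without constant term, which has a geometric inverse. *)
Lemma residue_of_max f : m (proj f) -> residue f = 0.
Proof.
have [[m0 mD mM] m1 _] := m_max.
move=> mf; apply/eqP/negPn/negP => nf; apply: m1.
pose t := residue f; pose f' : S := 1 - C (T t^-1) * f.
have /kerP[y Ey] : res (fpscoef f' 0%MM) = 0.
  rewrite fpscoefD fpscoefN fpscoefCM /= eqxx rmorphB rmorph1 rmorphM resT.
  by rewrite -/(residue f) mulVf // subrr.
pose h : S := f' - C pi * C y.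
have h1 : sord 1 h.
  move=> d; rewrite ltnS leqn0 mdeg_eq0 => /eqP->.
  by rewrite fpscoefD fpscoefN fpscoefCM Ey /= eqxx subrr.
have [g Eg] := mfps_geometric_inverse h1.
have E0 : proj (C pi * C y) = 0.
  by apply/proj0P; exists 0, 0, 0, 0, (C y); rewrite !mul0r !add0r.
have E1 : proj (1 - h) = proj (C (T t^-1)) * proj f.
  have -> : 1 - h = C (T t^-1) * f + C pi * C y.
    by rewrite /h /f' opprB opprD opprK addrCA addrC !addrA subrr add0r.
  by rewrite projD E0 addr0 projM.
by rewrite -proj_one -Eg projM mulrC; apply: (mM); rewrite E1; apply: mM.
Qed.

(** The classes of residue 0 form a proper ideal, which contains m by [residue_of_max]; maximality
    of m gives equality. So R / pi is local with residue field k. *)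
Lemma max_residueP f : m (proj f) <-> residue f = 0.
Proof.
split; first exact: residue_of_max.
have [[m0 mD mM] m1 mmax] := m_max.
pose I (x : Rpi) := exists2 g, residue g = 0 & x = proj g.
move=> rf; apply: (mmax I); last by exists f.
- split.
  + exists 0; first by rewrite /residue rmorph0.
    by apply/esym/proj0P; exists 0, 0, 0, 0, 0; rewrite !mul0r mulr0 !addr0.
  + move=> _ _ [g rg ->] [h rh ->]; exists (g + h); last by rewrite projD.
    by rewrite /residue fpscoefD rmorphD -/(residue g) rg add0r.
  + move=> x _ [g rg ->]; have [h <-] := proj_surj x; exists (h * g); last by rewrite projM.
    by rewrite /residue fpscoef0M rmorphM -/(residue g) rg mulr0.
- case=> g rg E; have : residue (1 - g) = 0.
    by apply: residue_of_proj0; rewrite projB proj_one E subrr.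
  rewrite /residue fpscoefD fpscoefN rmorphB -/(residue g) rg subr0 /= eqxx rmorph1.
  by move/eqP; rewrite oner_eq0.
move=> x mx; have [g E] := proj_surj x; exists g => //.
by apply: residue_of_max; rewrite E.
Qed.

Lemma sord_ideal_power N w : sord N w -> ideal_power m N (proj w).
Proof.
elim: N w => [|N IH] w hw; first exact: ideal_power0.
have [u [hu ->]] := sord_decomp hw; rewrite proj_sum.
apply: (big_ind (ideal_power m N.+1)); [exact: ideal_power_zero|exact: ideal_powerD|].
move=> i _; rewrite projM; apply: ideal_powerM; last exact: IH.
by apply/max_residueP; rewrite /residue /= eq_sym mnm1_eq0 rmorph0.
Qed.

(** A product of N elements of residue 0 reduces to order at least N. Conversely, subtracting lifts
    of the multiples of the relations leaves coefficients below degree N that are divisible by pi;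
    what remains modulo pi has order at least N. *)
Lemma ideal_powerP N f : ideal_power m N (proj f) <-> J N (red N f).
Proof.
split.
  case=> r [a [g [mg E]]].
  have /choice[A AP] i : exists A, proj A = a i by apply: proj_surj.
  have /choice[G GP] (ij : 'I_r * 'I_N) : exists B, proj B = g ij.1 ij.2 by apply: proj_surj.
  have E' : proj (f - \sum_i A i * \prod_j G (i, j)) = 0.
    rewrite projB E proj_sum; apply/eqP; rewrite subr_eq0; apply/eqP.
    apply: eq_bigr => i _; rewrite projM AP proj_prod; congr (_ * _).
    by apply: eq_bigr => j _; rewrite GP.
  have [J0 JD JM] := res_ideal_is_ideal (res al) (res be) N.
  have := proj0_res_ideal N E'; rewrite redD => h.
  suff h' : J N (red N (\sum_i A i * \prod_j G (i, j))).
    by have := JD _ _ h h'; rewrite redN subrK.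
  rewrite (big_morph (red N) (redD N) (red0 N)).
  apply: (big_ind (J N)) => // i _.
  have hG j : ordge 1 (red N (G (i, j))).
    move=> d; rewrite ltnS leqn0 mdeg_eq0 => /eqP->.
    rewrite mcoeff_red ?mdeg0; last exact: leq_ltn_trans (ltn_ord j).
    apply: residue_of_max.
    by rewrite GP; apply: mg.
  have hP : represents N (\prod_j G (i, j)) (\prod_j red N (G (i, j))).
    elim/big_rec2: _ => [|j p q _ h1]; first by have := @represents_nat N 1.
    exact: rM (@represents_red N _) h1.
  apply/(res_ideal_represents (rM (@represents_red N _) hP)).
  apply: res_ideal_ordge; apply: ordgeMl.
  have : ordge (\sum_(j < N) 1) (\prod_(j < N) red N (G (i, j))).
    elim/big_rec2: _ => [|j e p _ hp]; first exact: ordge_ge0.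
    exact: ordgeM.
  by rewrite sum_nat_const card_ord muln1.
case=> h1 [h2 [h3 [h4 [r [hr E]]]]].
pose H := lift_poly h1 * I1 v al + lift_poly h2 * I2 v al be
  + lift_poly h3 * I3 v be + lift_poly h4 * I4 v al be.
have hH : represents N H (h1 * rI1 (res al) + h2 * rI2 (res al) (res be)
    + h3 * rI3 (res be) + h4 * rI4 (res al) (res be)).
  exact (rD (rD (rD (rM (@represents_lift N h1) (@represents_I1 N))
    (rM (@represents_lift N h2) (@represents_I2 N)))
    (rM (@represents_lift N h3) (@represents_I3 N)))
    (rM (@represents_lift N h4) (@represents_I4 N))).
have low d : (mdeg d < N)%N -> exists y, fpscoef (f - H) d = pi * y.
  move=> dN; apply/kerP.
  have /representsP/(_ d dN) -> := rD (@represents_red N f) (rN hH).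
  by rewrite E mcoeffB mcoeffD hr // addr0 subrr.
(* One series collects the quotients by pi; its coefficients in degrees at least N are arbitrary. *)
have /choice[y yP] d : exists y, (mdeg d < N)%N -> fpscoef (f - H) d = pi * y.
  by case: (ltnP (mdeg d) N) => [/low[y Ey]|_]; [exists y|exists 0].
have -> : proj f = proj (f - H - C pi * MFps y).
  apply/esym/eqP; rewrite -subr_eq0 -projB; apply/eqP/proj0P.
  exists (- lift_poly h1), (- lift_poly h2), (- lift_poly h3), (- lift_poly h4), (- MFps y).
  by rewrite /H; ring.
apply: sord_ideal_power => d dN.
by rewrite fpscoefD fpscoefN fpscoefCM yP // subrr.
Qed.

(** [D] composed with [red N] descends to R / pi because series of class 0 reduce into [res_ideal];
    scalars act through the constants [C (T t)], of which only the residue t matters. *)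
Lemma quotient_length_ideal_power N l : codim (J N) l ->
  quotient_length (ideal_power m N) l.
Proof.
case=> D [Ds Dk].
have [J0 JD JM] := res_ideal_is_ideal (res al) (res be) N.
have /choice[lift liftP] := proj_surj.
pose del (x : Rpi) := D (red N (lift x)).
have delE f : del (proj f) = D (red N f).
  apply/eqP; rewrite /del -subr_eq0 -linearB -redN -redD; apply/eqP/Dk.
  by apply: proj0_res_ideal; rewrite projB liftP subrr.
have Drep f p : represents N f p -> D (red N f) = D p.
  move=> h; apply/eqP; rewrite -subr_eq0 -linearB; apply/eqP/Dk.
  exact: res_ideal_ordge.
apply: (@quotient_length_codim k Rpi _ m l N del (fun t => proj (C (T t)))).
- split.
  + exact: ideal_power_zero.
  + exact: ideal_powerD.
  + move=> x y; have [f <-] := proj_surj x; have [g <-] := proj_surj y.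
    rewrite -projM !ideal_powerP => Jg.
    by apply/(res_ideal_represents (rM (@represents_red N f) (@represents_red N g))); apply: JM.
- move=> x y; have [f <-] := proj_surj x; have [g <-] := proj_surj y.
  by rewrite -projD !delE redD linearD.
- move=> y; have [p <-] := Ds y; exists (proj (lift_poly p)).
  by rewrite delE; apply: Drep; apply: represents_lift.
- move=> x; have [f <-] := proj_surj x.
  by rewrite delE Dk ideal_powerP.
- move=> t x; have [f <-] := proj_surj x.
  rewrite -projM !delE (Drep _ _ (rM (@representsC N _) (@represents_red N f))).
  by rewrite resT mul_mpolyC linearZ.
- move=> x; have [f <-] := proj_surj x; exists (residue f).
  rewrite -projB; apply/max_residueP.
  by rewrite /residue fpscoefD fpscoefN rmorphB /= eqxx resT subrr.
move=> g mg; exists 1%N, (fun=> 1), (fun=> g); split=> //.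
by rewrite big_ord1 mul1r.
Qed.

End MaximalIdeal.
End Presentation.

(** * Hilbert polynomials *)

Section HilbertPolynomial.

(** The polynomial in t equal to 'C(t - d + 4, 4) for t at least d, with 24 = 4!; these are the
    coefficients of T^d / (1 - T)^5. *)
Definition binpoly (d : nat) : {poly rat} := 24%:R^-1 *:
  \prod_(x <- [:: d%:R - 4%:R; d%:R - 3%:R; d%:R - 2%:R; d%:R - 1]) ('X - x%:P).

Lemma horner_binpoly n d : (binpoly d).[(n + d)%:R] = 'C(n.+4, 4)%:R.
Proof.
have E : ('C(n.+4, 4) * 24 = n.+4 * n.+3 * n.+2 * n.+1)%N.
  by rewrite -[24%N]/(4`!) bin_ffact !ffactSS ffactn0; ring.
have -> : 'C(n.+4, 4)%:R = 24%:R^-1 * (n.+4 * n.+3 * n.+2 * n.+1)%:R :> rat.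
  by rewrite -E natrM mulrCA mulVf // mulr1.
rewrite /binpoly hornerZ !big_cons big_nil mulr1 !hornerM !hornerXsubC; congr (_ * _).
rewrite !natrM -(addn4 n) -(addn3 n) -(addn2 n) -(addn1 n) !natrD.
by ring.
Qed.

(** The Hilbert-Samuel polynomial of the series (a0 + a1 T + a2 T^2 + a3 T^3) / (1 - T)^5; the
    multiplicity is the numerator at T = 1. *)
Definition comb_poly (a0 a1 a2 a3 : rat) : {poly rat} :=
  a0 *: binpoly 0 + a1 *: binpoly 1 + a2 *: binpoly 2 + a3 *: binpoly 3.

Lemma comb_polyP a0 a1 a2 a3 e : (0 < e)%N -> a0 + a1 + a2 + a3 = e%:R ->
  [/\ comb_poly a0 a1 a2 a3 != 0, size (comb_poly a0 a1 a2 a3) = 5%N &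
      e%:R = (4`!)%:R * lead_coef (comb_poly a0 a1 a2 a3)].
Proof.
move=> e0 E; set Q := comb_poly _ _ _ _.
have szb d : (size (binpoly d) <= 5)%N.
  by apply: leq_trans (size_scale_leq _ _) _; rewrite size_prod_XsubC.
have cb d : (binpoly d)`_4 = 24%:R^-1.
  rewrite coefZ; set M := \prod_(x <- _) _.
  have : M \is monic by apply: monic_prod_XsubC.
  by rewrite monicE lead_coefE size_prod_XsubC /= => /eqP ->; rewrite mulr1.
have cQ : Q`_4 = e%:R / 24%:R by rewrite /Q /comb_poly !coefD ![(_ *: binpoly _)`_4]coefZ !cb -!mulrDl E.
have nQ : Q`_4 != 0.
  by rewrite cQ mulf_eq0 invr_eq0 negb_or !Num.Theory.pnatr_eq0 -!lt0n e0.
have sQ : size Q = 5%N.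
  apply/eqP; rewrite eqn_leq; apply/andP; split.
    have szZ c d : (size (c *: binpoly d) <= 5)%N by apply: leq_trans (size_scale_leq _ _) _.
    have szD (p q : {poly rat}) : (size p <= 5)%N -> (size q <= 5)%N -> (size (p + q)%R <= 5)%N.
      by move=> hp hq; apply: leq_trans (size_polyD _ _) _; rewrite geq_max hp.
    exact: (szD _ _ (szD _ _ (szD _ _ (szZ _ _) (szZ _ _)) (szZ _ _)) (szZ _ _)).
  by rewrite ltnNge; apply: contra nQ => /leq_sizeP->.
split=> //; first by rewrite -size_poly_eq0 sQ.
by rewrite lead_coefE sQ /= cQ mulrCA mulfV // mulr1.
Qed.

End HilbertPolynomial.

Section Multiplicities.
Variables (k : fieldType) (O : idomainType) (res : {rmorphism O -> k}) (pi : O).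
Hypothesis kerP : forall x, res x = 0 <-> exists y, x = pi * y.
Variable T : k -> O.
Hypothesis resT : forall t, res (T t) = t.
Variables (v al be : O).
Hypothesis res_v : res v = 0.
Variable m : def_ring_mod_pi v al be pi -> Prop.
Hypothesis m_max : is_maximal_ideal m.

Lemma multiplicity_of_codim a0 a1 a2 a3 e l N0 :
  (0 < e)%N -> a0 + a1 + a2 + a3 = e%:R ->
  (forall n, codim (res_ideal (res al) (res be) (n + N0).+1) (l n)) ->
  (forall n, (comb_poly a0 a1 a2 a3).[(n + N0)%:R] = (l n)%:R) ->
  hilbert_samuel_multiplicity m e.
Proof.
move=> e0 E cd ev; have [nQ sQ lQ] := comb_polyP e0 E.
exists (comb_poly a0 a1 a2 a3); split=> //; last by rewrite sQ.
exists N0 => n hn; rewrite -(subnK hn); exists (l (n - N0)%N) => //.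
exact: (quotient_length_ideal_power kerP resT res_v m_max (cd _)).
Qed.

Lemma multiplicity_unit : res al != 0 -> hilbert_samuel_multiplicity m 1.
Proof.
move=> na; apply: (@multiplicity_of_codim 1 0 0 0 1 (fun n => 'C(4 + n, 4)) 0) => //.
  by move=> n; rewrite addn0; apply: codim_res_ideal_unit.
move=> n; rewrite /comb_poly !hornerD ![(_ *: binpoly _).[_]]hornerZ !mul0r !addr0 mul1r.
exact: horner_binpoly.
Qed.

Lemma multiplicity_half : res al = 0 -> res be != 0 -> hilbert_samuel_multiplicity m 2.
Proof.
move=> a0 nb.
pose l n := ('C((5 + n).+2, 4) + 'C((5 + n).+1, 4) + 'C(5 + n, 3))%N.
(* The lengths have generating series (1 - T^e)(1 + T) / (1 - T)^6 + T^e / (1 - T)^4; for e = 1 the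
   numerator over (1 - T)^5 is 1 + 2 T - T^2. The offset is e + 2, as N = n + e + 3 is read as (n +
   3) + 1. *)
apply: (@multiplicity_of_codim 1 2%:R (-1) 0 2 l 3) => // n.
  have := codim_res_ideal0 (res be) n; rewrite /lform_ord (negPf nb) a0 /=.
  have -> : (n + 1).+3 = (n + 3).+1 by rewrite !addnS addn0.
  congr (codim _ _); rewrite /l.
  have -> : (6 + (n + 1).+2 = (5 + n).+4)%N by lia.
  have -> : (6 + (n + 1) = (5 + n).+2)%N by lia.
  have -> : (6 + n.+2 = (5 + n).+3)%N by lia.
  have -> : (6 + n = (5 + n).+1)%N by lia.
  have -> : (3 + n.+2 = 5 + n)%N by lia.
  by move: (5 + n)%N => x; rewrite !binS; lia.
rewrite /comb_poly !hornerD ![(_ *: binpoly _).[_]]hornerZ mul0r addr0.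
have bE d d' : (d + d' = 3)%N -> (binpoly d).[(n + 3)%:R] = 'C((n + d').+4, 4)%:R.
  by move=> dd; rewrite -(horner_binpoly _ d) -dd -addnA (addnC d').
rewrite (bE 0 3)%N // (bE 1 2)%N // (bE 2 1)%N //.
have -> : ((n + 3).+4 = (5 + n).+2)%N by lia.
have -> : ((n + 2).+4 = (5 + n).+1)%N by lia.
have -> : ((n + 1).+4 = 5 + n)%N by lia.
by rewrite /l; move: (5 + n)%N => x; rewrite !binS !natrD; ring.
Qed.

Lemma multiplicity_zero : res al = 0 -> res be = 0 -> hilbert_samuel_multiplicity m 4.
Proof.
move=> a0 b0.
pose l n := ('C((5 + n).+3, 4) + 2 * 'C((5 + n).+2, 4) + 'C((5 + n).+1, 4) + 'C(5 + n, 3))%N.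
(* For e = 2 the same series has numerator (1 + T)^2 + T^2 (1 - T) = 1 + 2 T + 2 T^2 - T^3, and the
   offset is 4. *)
apply: (@multiplicity_of_codim 1 2%:R 2%:R (-1) 4 l 4) => // n.
  have := codim_res_ideal0 (res be) n; rewrite /lform_ord b0 a0 eqxx /=.
  have -> : (n + 2).+3 = (n + 4).+1 by rewrite !addnS addn0.
  congr (codim _ _); rewrite /l.
  have -> : (6 + (n + 2).+2 = (5 + n).+4.+1)%N by lia.
  have -> : (6 + (n + 2) = (5 + n).+3)%N by lia.
  have -> : (6 + n.+2 = (5 + n).+3)%N by lia.
  have -> : (6 + n = (5 + n).+1)%N by lia.
  have -> : (3 + n.+2 = 5 + n)%N by lia.
  by move: (5 + n)%N => x; rewrite !binS; lia.
rewrite /comb_poly !hornerD ![(_ *: binpoly _).[_]]hornerZ.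
have bE d d' : (d + d' = 4)%N -> (binpoly d).[(n + 4)%:R] = 'C((n + d').+4, 4)%:R.
  by move=> dd; rewrite -(horner_binpoly _ d) -dd -addnA (addnC d').
rewrite (bE 0 4)%N // (bE 1 3)%N // (bE 2 2)%N // (bE 3 1)%N //.
have -> : ((n + 4).+4 = (5 + n).+3)%N by lia.
have -> : ((n + 3).+4 = (5 + n).+2)%N by lia.
have -> : ((n + 2).+4 = (5 + n).+1)%N by lia.
have -> : ((n + 1).+4 = 5 + n)%N by lia.
by rewrite /l; move: (5 + n)%N => x; rewrite !binS !natrD; ring.
Qed.

End Multiplicities.

(** * The residual character *)

Section Padic.
Variables (p : nat) (p_prime : prime p) (p_gt2 : (2 < p)%N).
Variables (Zp : idomainType) (resZp : {rmorphism Zp -> 'F_p}).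
Hypothesis Zp_witt : is_witt_ring p resZp.

Definition pdvd n (x : Zp) := exists u, x = p%:R ^+ n * u.

Lemma pdvd0 n : pdvd n 0.
Proof. by exists 0; rewrite mulr0. Qed.

Lemma pdvdD n x y : pdvd n x -> pdvd n y -> pdvd n (x + y).
Proof. by move=> [u ->] [w ->]; exists (u + w); rewrite mulrDr. Qed.

Lemma pdvdMl n x y : pdvd n y -> pdvd n (x * y).
Proof. by move=> [u ->]; exists (x * u); rewrite mulrCA. Qed.

Lemma pdvdMr n x y : pdvd n x -> pdvd n (x * y).
Proof. by rewrite mulrC; apply: pdvdMl. Qed.

Lemma pdvdN n x : pdvd n x -> pdvd n (- x).
Proof. by rewrite -mulN1r; apply: pdvdMl. Qed.

Lemma pdvd_le a b x : (a <= b)%N -> pdvd b x -> pdvd a x.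
Proof. by move=> ab [u ->]; rewrite -(subnKC ab) exprD -mulrA; exists (p%:R ^+ (b - a) * u). Qed.

Lemma pdvd_sum n I (r : seq I) (P : pred I) (F : I -> Zp) :
  (forall i, P i -> pdvd n (F i)) -> pdvd n (\sum_(i <- r | P i) F i).
Proof. by move=> h; apply: big_ind => //; [apply: pdvd0|apply: pdvdD]. Qed.

Lemma p_neq0 : p%:R != 0 :> Zp. Proof. by case: Zp_witt. Qed.

Lemma resZp0P x : resZp x = 0 <-> pdvd 1 x.
Proof. by case: Zp_witt => _ _ h _ _; rewrite h /pdvd expr1. Qed.

Lemma nat_approx x : exists n : nat, pdvd 1 (x - n%:R).
Proof.
exists (val (resZp x)); apply/resZp0P.
by rewrite rmorphB rmorph_nat natr_Zp subrr.
Qed.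

Lemma pdvd_nat n t : pdvd n (t%:R : Zp) -> (p ^ n %| t)%N.
Proof.
elim: n t => [|n IH] t [u E]; first by rewrite expn0 dvd1n.
have : pdvd 1 (t%:R : Zp) by apply: (@pdvd_le _ n.+1) => //; exists u.
move/resZp0P; rewrite rmorph_nat => /eqP.
rewrite -(dvdn_pcharf (pchar_Fp p_prime)) => /dvdnP[s Es].
rewrite Es expnSr dvdn_pmul2r ?prime_gt0 //; apply: IH; exists u.
apply: (mulIf p_neq0); rewrite -natrM -Es E exprSr.
by rewrite -!mulrA (mulrC u).
Qed.

Lemma one_plus_p_neq0 u : 1 + p%:R * u != 0 :> Zp.
Proof.
apply/eqP => /(congr1 resZp); rewrite rmorphD rmorph1 rmorph0.
have -> : resZp (p%:R * u) = 0 by apply/resZp0P; exists u; rewrite expr1.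
by rewrite addr0 => /eqP; rewrite oner_eq0.
Qed.

Lemma expr_one_plus_p n : pdvd 2 ((1 + p%:R) ^+ n - (1 + p%:R * n%:R) : Zp).
Proof.
elim: n => [|n [u IH]]; first by rewrite expr0 mulr0 addr0 subrr; apply: pdvd0.
rewrite exprSr; have -> : (1 + p%:R) ^+ n = 1 + p%:R * n%:R + p%:R ^+ 2 * u :> Zp by rewrite -IH [RHS]addrC subrK.
by exists (u * (1 + p%:R) + n%:R); rewrite mulrSr; ring.
Qed.

(** In the binomial expansion the middle terms carry d^2 and a factor p from 'C(p, i); the last term
    d^p is negligible because p is at least 3. *)
Lemma pdvd_pth_power n (s u : Zp) :
  pdvd n.+3 ((s + p%:R ^+ n.+1 * u) ^+ p - s ^+ p - p%:R ^+ n.+2 * u * s ^+ p.-1).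
Proof.
have [q pE] : exists q, p = q.+3 by exists (p - 3)%N; lia.
set d := p%:R ^+ n.+1 * u.
have dd : pdvd (n.+1 + n.+1) (d ^+ 2) by exists (u ^+ 2); rewrite /d exprMn -exprM muln2 addnn.
rewrite exprDn.
have -> : \sum_(i < p.+1) s ^+ (p - i) * d ^+ i *+ 'C(p, i) =
  s ^+ p + (p%:R * (d * s ^+ p.-1) +
    \sum_(i < q.+2) s ^+ (p - i.+2) * d ^+ i.+2 *+ 'C(p, i.+2)).
  rewrite pE !big_ord_recl /= subn0 expr0 mulr1 bin0 mulr1n; congr (_ + (_ + _)).
  by rewrite /bump /= subn1 expr1 bin1 mulr_natl mulrC.
rewrite [s ^+ p + _]addrC addrK.
have -> : p%:R * (d * s ^+ p.-1) = p%:R ^+ n.+2 * u * s ^+ p.-1.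
  by rewrite /d !exprS; ring.
rewrite addrAC subrr add0r; apply: pdvd_sum => i _.
have [ip|ip] := ltnP i.+2 p.
  have /dvdnP[c ->] : (p %| 'C(p, i.+2))%N by apply: prime_dvd_bin.
  rewrite -mulr_natr natrM -(addn2 i) exprD; case: dd => e ->.
  apply: (@pdvd_le _ (n.+1 + n.+1).+1); first by lia.
  by exists (s ^+ (p - (i + 2)) * d ^+ i * c%:R * e); rewrite exprS; ring.
rewrite -mulr_natr; apply: pdvdMr; apply: pdvdMl.
have [j ->] : exists j, i.+2 = (j + 3)%N by exists (i.+2 - 3)%N; lia.
rewrite exprD; apply: pdvdMl.
apply: (@pdvd_le _ (n.+1 * 3)); first by lia.
by exists (u ^+ 3); rewrite /d exprMn -exprM.
Qed.

(** Newton iteration: if y - s^p = p^(n+2) u, then s is corrected by p^(n+1) u, because s^(p-1) is 1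
    modulo p; completeness gives the limit. *)
Lemma pth_root w : exists w', (1 + p%:R * w') ^+ p = 1 + p%:R ^+ 2 * w :> Zp.
Proof.
set y := 1 + _ * w.
pose good n s := pdvd 1 (s - 1) /\ pdvd n.+2 (y - s ^+ p).
have step (ns : nat * Zp) : exists s', good ns.1 ns.2 ->
    good ns.1.+1 s' /\ pdvd ns.1.+1 (s' - ns.2).
  case: ns => n s /=.
  have [[g1 [u Eu]]|ng] := pselect (good n s); last by exists 0.
  exists (s + p%:R ^+ n.+1 * u) => _; split; last first.
    by rewrite addrAC subrr add0r; exists u.
  split; first by rewrite addrAC; apply: pdvdD => //; rewrite exprS -mulrA; exists (p%:R ^+ n * u).
  have [e Ee] := pdvd_pth_power n s u.
  have [g Eg] : pdvd 1 (s ^+ p.-1 - 1) by rewrite subrX1; apply: pdvdMr.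
  exists (- (u * g) - e).
  have -> : (s + p%:R ^+ n.+1 * u) ^+ p =
     p%:R ^+ n.+3 * e + s ^+ p + p%:R ^+ n.+2 * u * (1 + p%:R * g).
    rewrite -Ee -[in X in _ = X](expr1 p%:R) -Eg; ring.
  have -> : y = s ^+ p + p%:R ^+ n.+2 * u by rewrite -Eu [RHS]addrC subrK.
  rewrite [p%:R ^+ n.+3]exprS; move: (p%:R ^+ n.+2) (s ^+ p) => a b; ring.
have [f fP] := choice step.
pose s := fix s n := if n is n'.+1 then f (n', s n') else 1 : Zp.
have sP n : good n (s n).
  elim: n => [|n IH]; last by case: (fP (n, s n)).
  by split; [rewrite subrr; apply: pdvd0|rewrite expr1n /y addrAC subrr add0r; exists w].
have sS n : pdvd n.+1 (s n.+1 - s n) by case: (fP (n, s n) (sP n)).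
have [_ _ _ sep cpl] := Zp_witt.
have [l lP] : exists l, forall n, pdvd n (l - s n).
  by apply: cpl => n; apply: pdvd_le (sS n).
have [w' Ew] : pdvd 1 (l - 1).
  have -> : l - 1 = (l - s 1%N) + (s 1%N - 1) by rewrite addrA subrK.
  by apply: pdvdD (lP 1%N) _; case: (sP 1%N).
exists w'; have -> : 1 + p%:R * w' = l by rewrite -[p%:R]expr1 -Ew [LHS]addrC subrK.
apply/eqP; rewrite -subr_eq0; apply/eqP; apply: sep => n.
have -> : l ^+ p - y = (l ^+ p - s n ^+ p) - (y - s n ^+ p) by rewrite opprB addrA subrK.
apply: pdvdD; first by rewrite subrXX; apply: pdvdMr.
by apply: pdvdN; apply: (@pdvd_le _ n.+2); [lia|case: (sP n)].
Qed.

End Padic.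

(** * The character on the abelianization of G *)

Section ResidualCharacter.
Variables (p : nat) (p_prime : prime p) (p_gt2 : (2 < p)%N).
Variables (k : fieldType) (char_k : p \in [pchar k]).
Variables (Zp : idomainType) (resZp : {rmorphism Zp -> 'F_p}).
Hypothesis Zp_witt : is_witt_ring p resZp.
Variables (L : fieldType) (iota : {rmorphism {fraction Zp} -> L}).
Variables (G : groupType) (pr : absgal iota -> G).
Hypothesis prP : is_maximal_pro_p_quotient p pr.
Variable ab : G -> Zp * Zp.
Hypothesis abP : is_abelianization p pr ab.
Variables (gamma delta : G).
Hypothesis gammaP : ab gamma = (1 + p%:R, 0).
Hypothesis deltaP : ab delta = (1, 1).
Variable phi : absgal iota -> k.
Hypothesis rhoP : is_continuous_rep (rhobar phi).
Variable phiG : G -> k.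
Hypothesis phi_factor : forall s, phi s = phiG (pr s).

Lemma rhobar_eq1 s : rhobar phi s = 1%:M <-> phi s = 0.
Proof.
split=> [/matrixP/(_ 0 1)|h]; first by rewrite !mxE.
by apply/matrixP => i j; rewrite !mxE h; case: eqP; rewrite // if_same.
Qed.

Lemma phiM s t : phi (s * t)%g = phi s + phi t.
Proof.
case: rhoP => _ /(_ s t)/matrixP/(_ 0 1) + _; rewrite !mxE big_ord_recl big_ord1 !mxE /=.
by rewrite mul1r mulr1 addrC.
Qed.

Lemma phiGM g h : phiG (g * h)%g = phiG g + phiG h.
Proof.
case: prP => prM prS _; have [s <-] := prS g; have [t <-] := prS h.
by rewrite -prM -!phi_factor phiM.
Qed.

Lemma phiG1 : phiG 1%g = 0.
Proof. by apply: (addrI (phiG 1%g)); rewrite -phiGM mulg1 addr0. Qed.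

Lemma phiGV g : phiG (g^-1)%g = - phiG g.
Proof. by apply/eqP; rewrite -addr_eq0 -phiGM mulVg phiG1. Qed.

Lemma phiGX g n : phiG (g ^+ n)%g = phiG g *+ n.
Proof. by elim: n => [|n IH]; rewrite ?expg0 ?phiG1 // expgS phiGM IH mulrS. Qed.

(** The kernel of [phiG] is normal, contains all commutators because k is an abelian group, and is
    open by continuity; an element with trivial image under [ab] lies in every such subgroup. *)
Lemma phiG_ker_ab g : ab g = (1, 0) -> phiG g = 0.
Proof.
case: abP => _ _ abk /abk h; apply: (h (fun g => phiG g = 0)) => {h}.
- split; first exact: phiG1.
  + by move=> x y hx hy; rewrite phiGM hx hy addr0.
  + by move=> x hx; rewrite phiGV hx oppr0.
  + by move=> x y hx; rewrite conjgE !phiGM phiGV hx; ring.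
- case: rhoP => _ _ /(_ 1%:M) h s hs.
  have [|r hr] := h s; first by apply/rhobar_eq1; rewrite phi_factor.
  by exists r => t /hr/rhobar_eq1; rewrite phi_factor.
- by move=> x y; rewrite commgEl conjgE !phiGM !phiGV; ring.
Qed.

Lemma ab_fst g : exists u, (ab g).1 = 1 + p%:R * u.
Proof. by case: abP => _ h _; apply/(h _ (ab g).2); exists g; case: (ab g). Qed.

Lemma phiG_eq_ab g h : ab g = ab h -> phiG g = phiG h.
Proof.
case: abP => abM _ _ E; apply/eqP; rewrite -subr_eq0 -phiGV -phiGM; apply/eqP/phiG_ker_ab.
have := abM (g * h^-1)%g h; rewrite mulgVK E.
have [u Eu] := ab_fst h; have nz : (ab h).1 != 0 by rewrite Eu (one_plus_p_neq0 Zp_witt).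
move=> Eab; have E1 := congr1 fst Eab; have E2 := congr1 snd Eab => {Eab}.
move: E1 E2; case: (ab (g * h^-1)%g) => a b /= E1 E2; congr (_, _).
  by apply: (mulIf nz); rewrite mul1r -E1.
by apply: (addIr (ab h).2); rewrite add0r -E2.
Qed.

Lemma abX g n : ab (g ^+ n)%g = ((ab g).1 ^+ n, (ab g).2 *+ n).
Proof.
case: abP => abM _ _; elim: n => [|n IH].
  rewrite expg0 expr0 mulr0n.
  have := abM 1%g 1%g; rewrite mulg1; case: (ab 1%g) (ab_fst 1%g) => a b [u /= Eu] [E1 E2].
  have nz : a != 0 by rewrite Eu (one_plus_p_neq0 Zp_witt).
  congr (_, _); first by apply: (mulfI nz); rewrite mulr1.
  by apply: (addrI b); rewrite addr0.
by rewrite expgS abM IH exprS mulrS.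
Qed.

(** Dividing g by gamma^n delta^m leaves coordinates in 1 + p^2 Z_p and p Z_p. These are the
    coordinates of a p-th power, which [phiG] kills in characteristic p. *)
Lemma phiG_generated g m : pdvd p 1 ((ab g).2 - m%:R) ->
  exists n, phiG g = phiG gamma *+ n + phiG delta *+ m.
Proof.
move=> [u Eu]; have [c Ec] := ab_fst g; have [n [c' Ec']] := nat_approx Zp_witt c.
exists n; pose h := (gamma ^+ n * delta ^+ m)%g; pose g1 := (g * h^-1)%g.
case: (abP) => abM abS _.
have abh : ab h = ((1 + p%:R) ^+ n, m%:R).
  by rewrite abM !abX gammaP deltaP /= expr1n mulr1 mul0rn add0r.
have := abM g1 h; rewrite mulgVK abh.
have [x Ex] := ab_fst g1; rewrite Ex /=.
case E1 : (ab g) => [a b]; rewrite E1 /= in Eu Ec => -[Ea Eb].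
have [e Ee] := @expr_one_plus_p p Zp n.
have {}Ee : (1 + p%:R) ^+ n = 1 + p%:R * n%:R + p%:R ^+ 2 * e :> Zp.
  by rewrite -Ee [RHS]addrC subrK.
have {}Ec' : c = n%:R + p%:R * c' by rewrite -[p%:R]expr1 -Ec' [RHS]addrC subrK.
have [w Ew] : exists w, x = p%:R * w.
  (* From 1 + p c = (1 + p x)(1 + p n + p^2 e) with c = n + p c'. *)
  exists (c' - x * n%:R - e - p%:R * x * e).
  apply: (mulfI (p_neq0 Zp_witt)); apply: (addrI 1).
  have : 1 + p%:R * c = (1 + p%:R * x) * (1 + p%:R * n%:R + p%:R ^+ 2 * e).
    by rewrite -Ec Ea Ee.
  rewrite Ec' => E; have := subrr (1 + p%:R * c); rewrite Ec' {1}E => E2.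
  apply/eqP; rewrite -subr_eq0; apply/eqP; rewrite -[RHS]E2; ring.
have [w' Ew'] := pth_root p_prime p_gt2 Zp_witt w.
have [z Ez] : exists z, ab z = (1 + p%:R * w', u) by apply/abS; exists w'.
have Ez' : ab (z ^+ p)%g = ab g1.
  rewrite abX Ez /= Ew'; case E2 : (ab g1) Ex Eb => [a1 b1] /= -> Eb.
  congr (_, _); first by rewrite Ew expr2 mulrA.
  by apply: (addIr m%:R); rewrite -Eb -(mulr_natl u) -[p%:R]expr1 -Eu subrK.
have : phiG g1 = 0.
  by rewrite -(phiG_eq_ab Ez') phiGX -mulr_natr (pcharf0 char_k) mulr0.
rewrite phiGM phiGV phiGM !phiGX => /eqP; rewrite subr_eq0 => /eqP; exact.
Qed.

Lemma phi_eq0_of_generators : phiG gamma = 0 -> phiG delta = 0 -> forall s, phi s = 0.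
Proof.
move=> g0 d0 s; have [m hm] := nat_approx Zp_witt (ab (pr s)).2.
by have [n] := phiG_generated hm; rewrite phi_factor g0 d0 !mul0rn addr0.
Qed.

Lemma phiG_unramified_part g : phiG gamma = 0 -> pdvd p 1 (ab g).2 -> phiG g = 0.
Proof.
move=> g0 hg; have [|n] := @phiG_generated g 0; first by rewrite subr0.
by rewrite g0 mul0rn mulr0n addr0.
Qed.

End ResidualCharacter.

(** * Integers of the algebraic closure *)

Section Integrality.
Variables (p : nat) (p_prime : prime p).
Variables (Zp : idomainType) (resZp : {rmorphism Zp -> 'F_p}).
Hypothesis Zp_witt : is_witt_ring p resZp.
Variables (L : closedFieldType) (iota : {rmorphism {fraction Zp} -> L}).

Definition ZpL : {rmorphism Zp -> L} := iota \o (@tofrac Zp).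
Local Notation int := (integral_elt iota).
Local Notation inM := (in_max_ideal p iota).

Lemma int_add x y : int x -> int y -> int (x + y). Proof. exact: (@integral_add _ _ ZpL). Qed.
Lemma int_opp x : int x -> int (- x). Proof. exact: (@integral_opp _ _ ZpL). Qed.
Lemma int_mul x y : int x -> int y -> int (x * y). Proof. exact: (@integral_mul _ _ ZpL). Qed.
Lemma int_Zp a : int (ZpL a). Proof. exact: (integral_id ZpL). Qed.
Lemma int_nat n : int n%:R. Proof. exact: (integral_nat ZpL). Qed.
Lemma int0 : int 0. Proof. exact: (int_nat 0). Qed.
Lemma int1 : int 1. Proof. exact: (int_nat 1). Qed.

Lemma int_exp x n : int x -> int (x ^+ n).
Proof. by move=> hx; elim: n => [|n IH]; [apply: int1|rewrite exprS; apply: int_mul]. Qed.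

Lemma int_horner (q : {poly Zp}) x : int x -> int (map_poly ZpL q).[x].
Proof.
move=> hx; apply: (@integral_horner _ _ ZpL) => //; apply/integral_poly => i.
by rewrite coef_map; apply: int_Zp.
Qed.

Lemma ZpL_inj : injective ZpL.
Proof. by move=> x y /= /fmorph_inj/eqP; rewrite tofrac_eq => /eqP. Qed.

Lemma pL_neq0 : p%:R != 0 :> L.
Proof.
rewrite -(rmorph_nat ZpL) -(rmorph0 ZpL) (inj_eq ZpL_inj).
exact: p_neq0 Zp_witt.
Qed.

Lemma inM_mul a x : int a -> inM x -> inM (a * x).
Proof.
move=> ha [n hn]; exists n; rewrite exprMn -mulrA; apply: int_mul => //.
exact: int_exp.
Qed.

Lemma inM_opp x : inM x -> inM (- x).
Proof. by rewrite -mulN1r; apply: inM_mul; apply: int_opp; apply: int1. Qed.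

Lemma inM_add x y : int x -> int y -> inM x -> inM y -> inM (x + y).
Proof.
move=> hx hy [n hn] [n' hn']; exists (n + n')%N; rewrite exprDn mulr_suml.
apply: (big_ind int) => [||i _]; [exact: int0|exact: int_add|].
rewrite mulrnAl -mulr_natr; apply: int_mul; last exact: int_nat.
have [i'|i'] := leqP n' i.
  rewrite -(subnK i') [y ^+ (i - n' + n')]exprD -!mulrA.
  by apply: int_mul; [apply: int_exp|apply: int_mul => //; apply: int_exp].
have -> : (n + n' - i = (n' - i) + n)%N by rewrite -addnBA ?(ltnW i') // addnC.
have -> : x ^+ (n' - i + n) * y ^+ i / p%:R = x ^+ (n' - i) * y ^+ i * (x ^+ n / p%:R).
  by rewrite exprD; ring.
by apply: int_mul => //; apply: int_mul; apply: int_exp.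
Qed.

Lemma inM0 : inM 0.
Proof. by exists 1%N; rewrite mul0r; apply: int0. Qed.

Lemma inM_p : inM p%:R.
Proof. by exists 1%N; rewrite divff ?pL_neq0 //; apply: int1. Qed.

(** A monic equation of degree d for 1/p, multiplied by p^d and reduced modulo p, would keep only
    its leading term and read 1 = 0. *)
Lemma inM1 : ~ inM 1.
Proof.
case=> n; rewrite expr1n div1r => -[q mq].
rewrite /root -[map_poly _ q]/(map_poly ZpL q) => /eqP h.
have sq : (0 < size q)%N by rewrite size_poly_gt0 monic_neq0.
pose d := (size q).-1.
have E : \sum_(i < size q) q`_i * p%:R ^+ (d - i) = 0.
  apply: ZpL_inj; rewrite rmorph0 rmorph_sum /=.
  have sE : size (map_poly ZpL q) = size q.
    by rewrite size_map_poly_id0 // (monicP mq) rmorph1 oner_neq0.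
  move: h; rewrite horner_coef sE => /(congr1 ( *%R (p%:R ^+ d))).
  rewrite mulr0 => h; rewrite -[RHS]h mulr_sumr; apply: eq_bigr => i _.
  rewrite -[iota _]/(ZpL _) rmorphM rmorphXn rmorph_nat coef_map /= mulrCA; congr (_ * _).
  have id : (i <= d)%N by rewrite -ltnS prednK.
  rewrite -{2}(subnK id) exprD -mulrA -exprMn mulfV ?pL_neq0 // expr1n mulr1.
  by [].
have := congr1 resZp E; rewrite rmorph0 rmorph_sum /=.
have dlt : (d < size q)%N by rewrite prednK.
rewrite (bigD1 (Ordinal dlt)) //= subnn expr0 mulr1 -lead_coefE (monicP mq) rmorph1 big1.
  by rewrite addr0 => /eqP; rewrite oner_eq0.
move=> i ni; have [e ->] : exists e, (d - i = e.+1)%N.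
  have nid : val i != d by apply: contra ni => /eqP h'; apply/eqP/val_inj.
  have id : (i < d)%N by rewrite ltn_neqAle nid /= -ltnS prednK.
  by exists (d - i).-1; rewrite prednK // subn_gt0.
apply/(resZp0P Zp_witt); exists (q`_i * p%:R ^+ e); rewrite exprS expr1; ring.
Qed.

Section Automorphism.
Variable s : absgal iota.

Lemma galB x y : s (x - y) = s x - s y. Proof. by case: (gal_autP s). Qed.
Lemma galM x y : s (x * y) = s x * s y. Proof. by case: (gal_autP s) => _ _ []. Qed.
Lemma gal1 : s 1 = 1. Proof. by case: (gal_autP s) => _ _ []. Qed.
Lemma gal_Zp a : s (ZpL a) = ZpL a. Proof. by case: (gal_autP s) => _ _ _ h; apply: h. Qed.
Lemma gal_nat n : s n%:R = n%:R. Proof. by rewrite -(rmorph_nat ZpL) gal_Zp. Qed.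
Lemma gal0 : s 0 = 0. Proof. exact: (gal_nat 0). Qed.
Lemma galD x y : s (x + y) = s x + s y.
Proof. by rewrite -{1}[y]opprK galB -[- y]sub0r galB gal0 sub0r opprK. Qed.
Lemma galX x n : s (x ^+ n) = s x ^+ n.
Proof. by elim: n => [|n IH]; rewrite ?gal1 // !exprS galM IH. Qed.
Lemma gal_inj : injective s. Proof. by case: (gal_autP s) => /bij_inj. Qed.
Lemma galV x : s x^-1 = (s x)^-1.
Proof.
have [->|nx] := eqVneq x 0; first by rewrite invr0 gal0 invr0.
have nsx : s x != 0 by rewrite -gal0 (inj_eq gal_inj).
by apply: (mulIf nsx); rewrite -galM !mulVf // gal1.
Qed.

Lemma gal_horner (q : {poly {fraction Zp}}) x : s (map_poly iota q).[x] = (map_poly iota q).[s x].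
Proof.
rewrite !horner_coef (big_morph s galD gal0); apply: eq_bigr => i _.
by rewrite galM galX coef_map; case: (gal_autP s) => _ _ _ ->.
Qed.

Lemma gal_int x : int x -> int (s x).
Proof.
case=> q mq rq; exists q => //; move: rq.
rewrite -[map_poly _ q]/(map_poly ZpL q) map_poly_comp /root -gal_horner => /eqP->.
by rewrite gal0.
Qed.

Lemma gal_inM x : inM x -> inM (s x).
Proof. by case=> n hn; exists n; have := gal_int hn; rewrite galM galX galV gal_nat. Qed.

Lemma gal_iterP m : is_aut_over iota (iter m s).
Proof.
elim: m => [|m [b B [o M] f]]; first by split=> //; exists id.
split=> /=.
- by apply: (bij_comp (f := s)) b; case: (gal_autP s).
- by move=> x y; rewrite /= B galB.
- by split=> [|x y] /=; rewrite ?o ?gal1 // M galM.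
- by move=> x /=; rewrite f; case: (gal_autP s).
Qed.

Lemma gal_expE m x : gal_fun (s ^+ m)%g x = iter m s x.
Proof.
elim: m x => [|m IH] x; first by rewrite expg0.
by rewrite expgS /=; rewrite -IH.
Qed.

Hypothesis L_alg : forall x, algebraicOver iota x.

Lemma iter_period d e x : iter d s x = x -> iter (e * d) s x = x.
Proof. by move=> h; elim: e => // e IH; rewrite mulSn iterD IH. Qed.

Lemma iter_modn d e x : iter d s x = x -> iter e s x = iter (e %% d) s x.
Proof.
move=> h; rewrite {1}(divn_eq e d) addnC iterD; congr (iter _ _ _).
exact: iter_period.
Qed.

(** The iterates of x are among the finitely many roots of a polynomial. *)
Lemma gal_period x : exists2 d, (0 < d)%N & iter d s x = x.
Proof.
have [q nq rq] := L_alg x.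
have rs i : root (map_poly iota q) (iter i s x).
  by elim: i => // i; rewrite /root /= -gal_horner => /eqP->; rewrite gal0.
have nq' : map_poly iota q != 0 by rewrite map_poly_eq0.
pose N := size (map_poly iota q).
have [u|] := boolP (uniq (traject s x N)).
  have /(max_poly_roots nq')/(_ u) : all (root (map_poly iota q)) (traject s x N).
    by apply/allP => y /trajectP[i _ ->].
  by rewrite size_traject ltnn.
move=> /(uniqPn x)[i [i' [ii']]]; rewrite size_traject => i'N.
rewrite !nth_traject ?(ltn_trans ii') // => E.
exists (i' - i)%N; first by rewrite subn_gt0.
have: iter i s (iter (i' - i) s x) = iter i s x by rewrite -iterD subnKC // ltnW.
by apply: bij_inj; case: (gal_iterP i).
Qed.

(** Modulo d, the idempotent of Zhat that projects to Z_p. *)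
Definition ppart_exp d := chinese (d`_p) (d`_p^') 1 0.

Lemma ppart_exp_dvd d D e : (0 < D)%N -> (d %| D)%N ->
  e = 1 %[mod D`_p] -> e = 0 %[mod D`_p^'] -> e = ppart_exp d %[mod d].
Proof.
move=> D0 dD e1 e0; have d0 := dvdn_gt0 D0 dD.
have cop := coprime_partC p d d.
suff : e == ppart_exp d %[mod d`_p * d`_p^'] by rewrite partnC // => /eqP.
have m0 := chinese_modr cop 1 0; have m1 := chinese_modl cop 1 0.
rewrite chinese_remainder // /ppart_exp m0 m1.
apply/andP; split; apply/eqP.
  by rewrite -(modn_dvdm e (partn_dvd p D0 dD)) e1 modn_dvdm // partn_dvd.
by rewrite -(modn_dvdm e (partn_dvd p^' D0 dD)) e0 modn_dvdm // partn_dvd.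
Qed.

(* The limit of the powers [s ^+ e] with [e] tending to [1] in [Z_p] and to
   [0] in [Z_l] for the primes [l] other than [p]. *)
Lemma gal_ppart : exists s' : absgal iota, forall (r : seq L) D, (0 < D)%N ->
  exists e, [/\ e = 1 %[mod D`_p], e = 0 %[mod D`_p^']
              & {in r, forall x, s' x = iter e s x}].
Proof.
have /choice[d dP] x : exists d, (0 < d)%N /\ iter d s x = x.
  by have [d d0 dx] := gal_period x; exists d.
pose f x := iter (ppart_exp (d x)) s x.
have fP (r : seq L) D : (0 < D)%N -> exists e,
    [/\ e = 1 %[mod D`_p], e = 0 %[mod D`_p^'] & {in r, forall x, f x = iter e s x}].
  move=> D0; pose D' := (D * \prod_(x <- r) d x)%N.
  have D'0 : (0 < D')%N by rewrite muln_gt0 D0 prodn_gt0 // => x; case: (dP x).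
  have cop := coprime_partC p D' D'.
  have e1 := chinese_modl cop 1 0; have e0 := chinese_modr cop 1 0.
  have DD' : (D %| D')%N by apply: dvdn_mulr.
  exists (ppart_exp D'); split=> [||x xr].
  - by rewrite -(modn_dvdm _ (partn_dvd p D'0 DD')) e1 modn_dvdm // partn_dvd.
  - by rewrite -(modn_dvdm _ (partn_dvd p^' D'0 DD')) e0 modn_dvdm // partn_dvd.
  have [dx0 dx] := dP x.
  have dD : (d x %| D')%N by rewrite dvdn_mull // (big_rem x) //= dvdn_mulr.
  rewrite /f (iter_modn (ppart_exp (d x)) dx) [RHS](iter_modn _ dx).
  by rewrite (ppart_exp_dvd D'0 dD e1 e0).
suff fa : is_aut_over iota f.
  have fb : `[< is_aut_over iota f >] by apply/asboolP.
  by exists (mk_gal fb) => r D /(fP r).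
split.
- have finj : injective f.
    move=> x y; have [e [_ _ h]] := fP [:: x; y] 1%N isT.
    rewrite !h ?inE ?eqxx ?orbT //; apply: bij_inj; by case: (gal_iterP e).
  have fsur y : exists x, f x = y.
    have [dy0 dy] := dP y; pose e0 := ppart_exp (d y).
    (* On the orbit of y this is s to the power - e0, with a nonnegative exponent. *)
    pose x := iter (e0 * d y - e0) s y.
    have [e [e1 e2 h]] := fP [:: x] (d y) dy0; exists x.
    have dx : iter (d y) s x = x by rewrite -iterD addnC iterD dy.
    rewrite h ?inE // (iter_modn e dx) (ppart_exp_dvd dy0 (dvdnn _) e1 e2).
    rewrite -(iter_modn _ dx) -/e0 -iterD subnKC; last exact: leq_pmulr.
    exact: iter_period.
  have [g gP] := choice fsur.
  by exists g => x //; apply: finj.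
- move=> x y; have [e [_ _ h]] := fP [:: x; y; x - y] 1%N isT.
  by rewrite !h ?inE ?eqxx ?orbT //; case: (gal_iterP e).
- split; first by have [e [_ _ h]] := fP [:: 1] 1%N isT; rewrite h ?inE //;
    case: (gal_iterP e) => _ _ [].
  move=> x y; have [e [_ _ h]] := fP [:: x; y; x * y] 1%N isT.
  by rewrite !h ?inE ?eqxx ?orbT //; case: (gal_iterP e) => _ _ [].
- move=> x; have [e [_ _ h]] := fP [:: iota x] 1%N isT.
  by rewrite h ?inE //; case: (gal_iterP e).
Qed.

End Automorphism.

(** Modulo p and q the powers X^(p^i) take finitely many values, so two of them agree. Their
    difference is the p^i-th power of X^(p^(j-i)) - X; at x, a root of q, it becomes a multiple of
    p. *)
Lemma residue_finite x : int x -> exists2 f, (0 < f)%N & inM (x ^+ (p ^ f) - x).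
Proof.
move=> hx; have [q mq rq] := hx.
pose q' := map_poly resZp q.
have mq' : q' \is monic by apply: monic_map.
pose d := (size q').-1.
have sq' : size q' = d.+1 by rewrite prednK // size_poly_gt0 monic_neq0.
have rsz (h : {poly 'F_p}) : (size (h %% q')%R <= d)%N.
  by rewrite -ltnS -sq' ltn_modp monic_neq0.
pose F (i : 'I_(#|{: 'rV['F_p]_d}|.+1)) : 'rV['F_p]_d := poly_rV ('X^(p ^ i) %% q').
have [i [j [ij E]]] : exists i j : 'I_(#|{: 'rV['F_p]_d}|.+1), (i < j)%N /\ F i = F j.
  have : ~~ injectiveb F.
    by apply/injectiveP => /leq_card; rewrite card_ord ltnn.
  move=> /injectivePn[i [j nij E]]; case: (ltngtP i j) => [ij|ji|ij].
  - by exists i, j.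
  - by exists j, i.
  - by case/eqP: nij; apply: val_inj.
exists (j - i)%N; first by rewrite subn_gt0.
have chX : p \in [pchar {poly 'F_p}] by rewrite pchar_poly pchar_Fp.
have pn : ([pchar {poly 'F_p}]).-nat (p ^ i)%N.
  by rewrite pnatX pnatE // chX.
have dv : q' %| ('X^(p ^ (j - i)) - 'X) ^+ (p ^ i).
  have -> : ('X^(p ^ (j - i)) - 'X) ^+ (p ^ i) = 'X^(p ^ j) - 'X^(p ^ i) :> {poly 'F_p}.
    by rewrite exprDn_pchar // exprNn_pchar // -exprM -expnD subnK // ltnW.
  rewrite /dvdp modpD modpN subr_eq0; apply/eqP.
  by rewrite -(poly_rV_K (rsz _)) -[RHS](poly_rV_K (rsz _)); congr rVpoly; apply/esym.
have [_ /choice[lift liftP] _ _ _] := Zp_witt.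
pose h := ('X^(p ^ (j - i)) - 'X) ^+ (p ^ i) %/ q'.
pose hl : {poly Zp} := \poly_(n < size h) lift h`_n.
have hlE : map_poly resZp hl = h.
  apply/polyP => n; rewrite coef_map coef_poly /=; case: ltnP => [_|le].
    exact: liftP.
  by rewrite rmorph0 nth_default.
pose R : {poly Zp} := ('X^(p ^ (j - i)) - 'X) ^+ (p ^ i) - hl * q.
have R0 : map_poly resZp R = 0.
  rewrite rmorphB rmorphXn rmorphB rmorphM /= map_polyXn map_polyX hlE.
  by rewrite divpK // subrr.
have /choice[c cP] n : exists c, R`_n = p%:R * c.
  have /(resZp0P Zp_witt)[c] : resZp R`_n = 0 by rewrite -coef_map R0 coef0.
  by rewrite expr1 => ->; exists c.
pose R' : {poly Zp} := \poly_(n < size R) c n.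
have RE : R = p%:R *: R'.
  apply/polyP => n; rewrite coefZ coef_poly; case: ltnP => // le.
  by rewrite mulr0 nth_default.
exists (p ^ i)%N.
have -> : (x ^+ (p ^ (j - i)) - x) ^+ (p ^ i) = p%:R * (map_poly ZpL R').[x].
  have : (map_poly ZpL R).[x] = (x ^+ (p ^ (j - i)) - x) ^+ (p ^ i).
    rewrite rmorphB rmorphXn rmorphB rmorphM /= !hornerE.
    rewrite map_polyXn map_polyX !hornerE.
    move: rq; rewrite /root -[map_poly _ q]/(map_poly ZpL q) => /eqP->.
    by rewrite mulr0 subr0.
  by rewrite RE linearZ /= hornerZ => <-; rewrite -[iota _]/(ZpL _) rmorph_nat.
by rewrite mulrAC mulfV ?pL_neq0 // mul1r; apply: int_horner.
Qed.

End Integrality.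

(** * Inertia and the unramified coordinate *)

Section Inertia.
Variables (p : nat) (p_prime : prime p).
Variables (Zp : idomainType) (resZp : {rmorphism Zp -> 'F_p}).
Hypothesis Zp_witt : is_witt_ring p resZp.
Variables (L : closedFieldType) (iota : {rmorphism {fraction Zp} -> L}).
Hypothesis L_alg : forall x, algebraicOver iota x.
Variable unr : absgal iota -> Zp.
Hypothesis unrP : is_unramified_coordinate p unr.
Local Notation int := (integral_elt iota).
Local Notation inM := (in_max_ideal p iota).

Lemma exists_prim_root N : N%:R != 0 :> L -> exists z : L, N.-primitive_root z.
Proof.
move=> nN; have N0 : (0 < N)%N by rewrite lt0n; apply: contraNneq nN => ->.
have [r Er] := closed_field_poly_normal ('X^N - 1 : {poly L}).
rewrite (lead_coefDl _) ?size_polyXn ?size_polyN ?size_poly1 ?ltnS // in Er.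
rewrite lead_coefXn scale1r in Er.
have ur : uniq r by rewrite -separable_prod_XsubC -Er separable_Xn_sub_1.
have sr : size r = N.
  by have := congr1 (fun q : {poly L} => size q) Er;
    rewrite /= size_prod_XsubC size_XnsubC // => -[].
have : has N.-primitive_root r.
  apply: cyclic.has_prim_root => //; last by rewrite sr.
  apply/allP => x xr; rewrite /root_of_unity; change (root ('X^N - 1) x).
  by rewrite Er root_prod_XsubC.
by case/hasP => z _ hz; exists z.
Qed.

(** If y were not 1, its powers would sum to 0, and N would be minus the sum of the y^i - 1, which
    lies in the maximal ideal. *)
Lemma root_unity_reduction N y : y ^+ N = 1 -> int y -> inM (y - 1) ->
  ~ inM (N%:R) -> y = 1.
Proof.
move=> yN iy my nN; apply/eqP/negPn/negP => ny; apply: nN.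
have S0 : \sum_(i < N) y ^+ i = 0.
  have := subrX1 y N; rewrite yN subrr => /esym/eqP.
  by rewrite mulf_eq0 subr_eq0 (negPf ny) => /eqP.
have -> : N%:R = - \sum_(i < N) (y ^+ i - 1) :> L.
  by rewrite sumrB S0 sub0r opprK sumr_const card_ord.
apply: inM_opp; suff [] : int (\sum_(i < N) (y ^+ i - 1)) /\ inM (\sum_(i < N) (y ^+ i - 1)) by [].
apply: (big_ind (fun z => int z /\ inM z)).
- by split; [apply: int0|apply: inM0].
- by move=> u w [iu mu] [iw mw]; split; [apply: int_add|apply: inM_add].
move=> i _; split; first by apply: int_add; [apply: int_exp|apply: int_opp; apply: int1].
rewrite subrX1 mulrC; apply: inM_mul => //.
by apply: (big_ind int) => [||j _]; [apply: int0|apply: int_add|apply: int_exp].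
Qed.

(** Tested on a primitive root of unity of order p^p - 1, which generates the residue field with p^p
    elements: s fixes its residue and acts on it as the t-th power of a Frobenius of order p, so p
    divides t. *)
Lemma unr_inertia s : inertia p s -> pdvd p 1 (unr s).
Proof.
move=> hs; have [t ht hu] := unrP s (prime_gt0 p_prime).
have [u Eu] : exists u, unr s - t%:R = p%:R ^+ 1 * u by apply: hu; rewrite expn1.
suff /dvdnP[c Ec] : (p %| t)%N.
  exists (u + c%:R); rewrite mulrDr -Eu Ec natrM expr1 [p%:R * _]mulrC.
  by rewrite subrK.
pose N := (p ^ p - 1)%N; have p1 := prime_gt1 p_prime.
have N1 : (N.+1 = p ^ p)%N by rewrite /N subn1 prednK // expn_gt0 prime_gt0.
have N0 : (0 < N)%N.
  by rewrite -ltnS N1 -{1}(exp1n p) ltn_exp2r // prime_gt0.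
have nN : ~ inM (N%:R).
  move=> h; apply: (inM1 (iota := iota) Zp_witt).
  have E : p%:R ^+ p - N%:R = 1 :> L by rewrite -natrX -N1 -addn1 natrD addrAC subrr add0r.
  suff : inM (p%:R ^+ p - N%:R) by rewrite E.
  apply: inM_add; [by apply: int_exp; apply: int_nat|by apply: int_opp; apply: int_nat| |exact: inM_opp].
  rewrite -(prednK (prime_gt0 p_prime)) exprSr prednK ?prime_gt0 //.
  by apply: inM_mul; [apply: int_exp; apply: int_nat|apply: (inM_p Zp_witt)].
have [z zP] : exists z : L, N.-primitive_root z.
  by apply: exists_prim_root; apply/eqP => h; apply: nN; rewrite h; apply: inM0.
have zN := prim_expr_order zP.
have iz : int z.
  exists ('X^N - 1); first by rewrite monicXnsubC.
  rewrite -[map_poly _ _]/(map_poly (ZpL iota) ('X^N - 1)) rmorphB /= map_polyXn rmorph1.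
  by rewrite /root !hornerE zN subrr.
have zp : z ^+ (p ^ p) = z by rewrite -N1 exprS zN mulr1.
(* Reduction is injective on N-th roots of unity, so the congruence becomes an equality. *)
have zt : z ^+ (p ^ t) = z.
  have mz : inM (z ^+ (p ^ t) - z).
    have -> : z ^+ (p ^ t) - z = (s z - z) - (s z - z ^+ (p ^ t)) by ring.
    apply: inM_add.
    - by apply: int_add; [apply: gal_int|apply: int_opp].
    - by apply: int_opp; apply: int_add; [apply: gal_int|apply: int_opp; apply: int_exp].
    - exact: hs.
    - by apply: inM_opp; apply: ht => //; rewrite zp subrr; apply: inM0.
  have E : z ^+ (p ^ t) = z * z ^+ (p ^ t).-1 by rewrite -exprS prednK // expn_gt0 prime_gt0.
  suff y1 : z ^+ (p ^ t).-1 = 1 by rewrite E y1 mulr1.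
  apply: (@root_unity_reduction N) => //.
  - by rewrite exprAC zN expr1n.
  - exact: int_exp.
  have -> : z ^+ (p ^ t).-1 - 1 = z ^+ N.-1 * (z ^+ (p ^ t) - z).
    by rewrite E mulrBr mulrA -exprSr prednK // zN mul1r.
  by apply: inM_mul => //; apply: int_exp.
have zm c : z ^+ (p ^ (p * c)) = z.
  by elim: c => [|c IH]; rewrite ?muln0 ?expr1 // mulnS expnD exprM zp.
have zr : z ^+ (p ^ (t %% p)) = z.
  by move: zt; rewrite {1}(divn_eq t p) expnD exprM mulnC zm.
rewrite /dvdn; set r := (t %% p)%N in zr *.
have rp : (r < p)%N by rewrite ltn_mod prime_gt0.
have : (N %| (p ^ r).-1)%N.
  have nz : z != 0 by apply/eqP => z0; move: zN; rewrite z0 expr0n gtn_eqF // => /eqP; rewrite eq_sym oner_eq0.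
  rewrite (prim_order_dvd zP); apply/eqP; apply: (mulfI nz).
  by rewrite mulr1 -exprS prednK // expn_gt0 prime_gt0.
have lt : (p ^ r < p ^ p)%N by rewrite ltn_exp2l.
have : (0 < p ^ r)%N by rewrite expn_gt0 prime_gt0.
move=> pr0; case: (posnP (p ^ r).-1) => [E _|pos /dvdn_leq].
  have : (p ^ r = p ^ 0)%N by rewrite expn0 -(prednK pr0) E.
  by move/eqP; rewrite eqn_exp2l.
by move/(_ pos); rewrite -ltnS prednK // N1 leqNgt lt.
Qed.

Lemma unr0_frob_part s f t : unr s = 0 ->
  (forall n, (p ^ n %| f)%N -> exists u, unr s - t%:R = p%:R ^+ n * u) ->
  (0 < f)%N -> (f`_p %| t)%N.
Proof.
move=> u0 h f0; rewrite p_part; apply: (pdvd_nat p_prime Zp_witt).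
have [u] := h (logn p f) (pfactor_dvdnn p f); rewrite u0 sub0r => E.
by exists (- u); rewrite mulrN -E opprK.
Qed.

Lemma inM_congr_exp x y n : int x -> int y -> inM (x - y) -> inM (x ^+ n - y ^+ n).
Proof.
move=> ix iy h; rewrite subrXX mulrC; apply: inM_mul => //.
apply: (big_ind int) => [||j _]; [exact: int0|exact: int_add|].
by apply: int_mul; apply: int_exp.
Qed.

Lemma inM_trans x y z : int x -> int y -> int z ->
  inM (x - y) -> inM (y - z) -> inM (x - z).
Proof.
move=> ix iy iz h1 h2; have -> : x - z = (x - y) + (y - z) by rewrite addrA subrK.
by apply: inM_add => //; apply: int_add => //; apply: int_opp.
Qed.

(** On the field with p^f elements s acts as the t-th power of Frobenius, where the p-part of f
    divides t and the prime-to-p part divides e; so s^e acts trivially there. The congruence e = 1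
    modulo p lets phi take the same value on s' and s. *)
Lemma inertia_ppart s : unr s = 0 -> exists2 s' : absgal iota, inertia p s' &
  forall r : seq L, exists2 e, e = 1 %[mod p] & {in r, forall x, s' x = iter e s x}.
Proof.
move=> u0; have [s' hs'] := gal_ppart p s L_alg; exists s'; last first.
  move=> r; have [e [e1 _ h]] := hs' r p (prime_gt0 p_prime); exists e => //.
  by move: e1; rewrite part_pnat_id // pnat_id.
move=> x ix; have [f f0 hf] := residue_finite p_prime Zp_witt ix.
have [t ht hu] := unrP s f0; have tf := unr0_frob_part u0 hu f0.
have [e [_ e0 h]] := hs' [:: x] f f0.
rewrite h ?inE //; have iiter i : int (iter i s x) by elim: i => //= i; apply: gal_int.
have step i : inM (iter i s x - x ^+ (p ^ (t * i))).
  elim: i => [|i IH]; first by rewrite muln0 expr1 subrr; apply: inM0.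
  apply: (@inM_trans _ (s (x ^+ (p ^ (t * i))))); rewrite ?galX.
  - exact: iiter.
  - by apply: int_exp; apply: gal_int.
  - exact: int_exp.
  - by rewrite /= -galX -galB; apply: (gal_inM s IH).
  rewrite mulnS expnD exprM; apply: inM_congr_exp; [exact: gal_int|exact: int_exp|].
  exact: ht.
have per c : inM (x ^+ (p ^ (f * c)) - x).
  elim: c => [|c IH]; first by rewrite muln0 expr1 subrr; apply: inM0.
  apply: (@inM_trans _ (x ^+ (p ^ (f * c)))) => //; do ?exact: int_exp.
  by rewrite mulnS expnD exprM; apply: inM_congr_exp => //; apply: int_exp.
have /dvdnP[c Ec] : (f %| t * e)%N.
  rewrite -(partnC p f0); apply: dvdn_mul => //.
  by apply/eqP; rewrite -[RHS](mod0n f`_p^') -e0.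
apply: (@inM_trans _ (x ^+ (p ^ (t * e)))) => //; first exact: int_exp.
by rewrite Ec mulnC; apply: per.
Qed.

End Inertia.

(** * Ramification in terms of gamma *)

Section RamifiedCharacter.
Variables (p : nat) (p_prime : prime p) (p_gt2 : (2 < p)%N).
Variables (k : fieldType) (char_k : p \in [pchar k]).
Variables (Zp : idomainType) (resZp : {rmorphism Zp -> 'F_p}).
Hypothesis Zp_witt : is_witt_ring p resZp.
Variables (L : closedFieldType) (iota : {rmorphism {fraction Zp} -> L}).
Hypothesis L_alg : forall x, algebraicOver iota x.
Variables (eps unr : absgal iota -> Zp).
Hypothesis unrP : is_unramified_coordinate p unr.
Variables (G : groupType) (pr : absgal iota -> G).
Hypothesis prP : is_maximal_pro_p_quotient p pr.
Variable ab : G -> Zp * Zp.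
Hypothesis abP : is_abelianization p pr ab.
Hypothesis ab_coord : forall s, ab (pr s) = (eps s ^+ p.-1, unr s).
Variables (gamma delta : G).
Hypothesis gammaP : ab gamma = (1 + p%:R, 0).
Hypothesis deltaP : ab delta = (1, 1).
Variable phi : absgal iota -> k.
Hypothesis rhoP : is_continuous_rep (rhobar phi).
Variable phiG : G -> k.
Hypothesis phi_factor : forall s, phi s = phiG (pr s).

(** Continuity is what evaluates phi at the element s' of inertia made from a lift s of gamma: s'
    agrees with some s^e, e = 1 modulo p, on the finite list that decides whether phi vanishes, and
    phi(s^e) = e phi(s) = phi(gamma). *)
Lemma ramified_iff : ramified p (rhobar phi) <-> phiG gamma != 0.
Proof.
split=> [[s hs nrho]|na].
  apply/eqP => g0; apply: nrho; apply/rhobar_eq1; rewrite phi_factor.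
  apply: (phiG_unramified_part p_prime p_gt2 char_k Zp_witt prP abP gammaP deltaP rhoP
    phi_factor g0).
  by rewrite ab_coord; apply: (unr_inertia p_prime Zp_witt unrP).
have [_ prS _] := prP; have [s Es] := prS gamma.
have u0 : unr s = 0 by have := ab_coord s; rewrite Es gammaP => -[].
have [s' is' hs'] := inertia_ppart p_prime Zp_witt L_alg unrP u0.
exists s' => // /rhobar_eq1 h0.
have [_ _ /(_ 1%:M) op] := rhoP.
have [|r hr] := op s'; first by apply/rhobar_eq1.
have [e e1 he] := hs' r.
have /hr/rhobar_eq1 : {in r, forall x, gal_fun (s ^+ e)%g x = s' x}.
  by move=> x xr; rewrite gal_expE he.
have phiX i : phi (s ^+ i)%g = phi s *+ i.
  elim: i => [|i IH]; last by rewrite expgS (phiM rhoP) IH mulrS.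
  by rewrite expg0; apply: (addrI (phi 1%g)); rewrite -(phiM rhoP) mulg1 addr0.
rewrite phiX phi_factor Es -mulr_natr => /eqP; rewrite mulf_eq0 (negPf na) /=.
rewrite -(dvdn_pcharf char_k) /dvdn e1 modn_small ?prime_gt1 //.
Qed.

Lemma unramified_indecomposable_generators : unramified_indecomposable p (rhobar phi) ->
  phiG gamma = 0 /\ phiG delta != 0.
Proof.
case=> ns nr; have g0 : phiG gamma = 0 by apply/eqP/negPn/negP => /ramified_iff.
split=> //; apply/eqP => d0; apply: ns => s; apply/rhobar_eq1.
exact: (phi_eq0_of_generators p_prime p_gt2 char_k Zp_witt prP abP gammaP deltaP rhoP
  phi_factor g0 d0).
Qed.

Lemma split_rep_phiG g : split_rep (rhobar phi) -> phiG g = 0.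
Proof.
move=> h; have [_ prS _] := prP; have [s <-] := prS g.
by rewrite -phi_factor; apply/rhobar_eq1.
Qed.

End RamifiedCharacter.

Theorem theorem2
  (* the coefficient ring *)
  (p : nat) (p_prime : prime p) (p_gt2 : (2 < p)%N)
  (k : finFieldType) (char_k : p \in [pchar k])
  (W : idomainType) (resW : {rmorphism W -> k}) (W_witt : is_witt_ring p resW)
  (E : fieldExtType {fraction W})
  (O : idomainType) (j : {rmorphism O -> E}) (O_int : is_ring_of_integers j)
  (resO : {rmorphism O -> k}) (pi : O)
  (E_tot_ram : is_totally_ramified resW j resO pi)
  (teich : k -> O) (teichP : is_teichmuller resO teich)
  (* Q_p, its algebraic closure, and the characters of its Galois group *)
  (Zp : idomainType) (resZp : {rmorphism Zp -> 'F_p})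
  (Zp_witt : is_witt_ring p resZp)
  (ZpO : {rmorphism Zp -> O})
  (L : closedFieldType) (iota : {rmorphism {fraction Zp} -> L})
  (L_alg : forall x, algebraicOver iota x)
  (eps : absgal iota -> Zp) (epsP : is_cyclotomic_character p eps)
  (unr : absgal iota -> Zp) (unrP : is_unramified_coordinate p unr)
  (* the maximal pro-p quotient and its abelianization *)
  (G : groupType) (pr : absgal iota -> G) (prP : is_maximal_pro_p_quotient p pr)
  (ab : G -> Zp * Zp) (abP : is_abelianization p pr ab)
  (ab_coord : forall s, ab (pr s) = (eps s ^+ p.-1, unr s))
  (gamma delta : G)
  (gammaP : ab gamma = (1 + p%:R, 0)) (deltaP : ab delta = (1, 1))
  (* the residual representation *)
  (phi : absgal iota -> k) (rhoP : is_continuous_rep (rhobar phi))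
  (phiG : G -> k) (phi_factor : forall s, phi s = phiG (pr s)) :
  let v : O := (1 - ZpO (ab gamma).1) / 2%:R in
  let Rpi :=
    def_ring_mod_pi v (teich (phiG gamma)) (teich (phiG delta)) pi in
  forall m : Rpi -> Prop, is_maximal_ideal m ->
    [/\ ramified p (rhobar phi) -> hilbert_samuel_multiplicity m 1,
        unramified_indecomposable p (rhobar phi) ->
          hilbert_samuel_multiplicity m 2
      & split_rep (rhobar phi) -> hilbert_samuel_multiplicity m 4].
Proof.
move=> v Rpi m m_max.
have [_ resP] := E_tot_ram; have [resT _] := teichP.
have res_v : resO v = 0.
  rewrite /v gammaP /= rmorphM rmorphB rmorph1 rmorphD rmorph1 rmorph_nat rmorphD rmorph1.
  by rewrite rmorph_nat (pcharf0 char_k) addr0 subrr mul0r.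
have ram := ramified_iff p_prime p_gt2 char_k Zp_witt L_alg unrP prP abP ab_coord
  gammaP deltaP rhoP phi_factor.
split.
- move=> /ram na; apply: (multiplicity_unit resP resT res_v m_max).
  by rewrite resT.
- move=> /(unramified_indecomposable_generators p_prime p_gt2 char_k Zp_witt L_alg
    unrP prP abP ab_coord gammaP deltaP rhoP phi_factor)[a0 nb].
  by apply: (multiplicity_half resP resT res_v m_max); rewrite resT.
move=> sp; have phi0 := split_rep_phiG prP phi_factor _ sp.
by apply: (multiplicity_zero resP resT res_v m_max); rewrite resT.
Qed.
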